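(* Let $R$ be a commutative Noetherian ring, $S$ a module-finite $R$-algebra, and $M$ and $N$ finitely generated right $S$-modules. Let $X:=j\text{-}\operatorname{Spec}(R)\cap\operatorname{Supp}_R(N)$, and suppose that $\dim(X)<\infty$. Then \[\operatorname{sur}_S(M,N)\geqslant\inf\{\operatorname{sur}_{S_{\mathfrak p}}(M_{\mathfrak p},N_{\mathfrak p})-\dim_X(\mathfrak p):\mathfrak p\in X\}.\]
   Context: Every ring has a $1$ and every module is unital; $S$ need not be commutative. A module-finite $R$-algebra is an $R$-algebra that is finitely generated as an $R$-module; right $S$-modules are viewed as $R$-modules in the natural way, and for $\mathfrak p\in\operatorname{Spec}(R)$, $M_{\mathfrak p}$, $N_{\mathfrak p}$, $S_{\mathfrak p}$ denote localizations at $R-\mathfrak p$. For an algebra $S$ over a commutative ring and right $S$-modules $M,N$, $\operatorname{sur}_S(M,N)$ denotes the supremum (possibly $\infty$) of the nonnegative integers $t$ such that there exists a surjective $S$-linear map from $M$ to $N^{\oplus t}$. $j\text{-}\operatorname{Spec}(R)$ is the set of all $\mathfrak p\in\operatorname{Spec}(R)$ that can be expressed as an intersection of maximal ideals of $R$. $\operatorname{Supp}_R(N)=\{\mathfrak p\in\operatorname{Spec}(R):N_{\mathfrak p}\neq0\}$. Every subset of $\operatorname{Spec}(R)$ carries the subspace topology induced by the Zariski topology, and $\dim$ of such a subset is its Krull dimension as a topological space, with $\dim(\varnothing)=-\infty$. For $\mathfrak p\in X\subseteq\operatorname{Spec}(R)$, $\dim_X(\mathfrak p)$ is the Krull dimension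 of $\operatorname{Var}(\mathfrak p)\cap X$, where $\operatorname{Var}(\mathfrak p)=\{\mathfrak q\in\operatorname{Spec}(R):\mathfrak p\subseteq\mathfrak q\}$. The infimum of the empty set is $\infty$. *)

(* Defs.v *)
From HB Require Import structures.
From mathcomp Require Import all_boot all_order all_algebra generic_quotient.
From mathcomp Require Import all_classical.
From mathcomp Require Import constructive_ereal topology ring.

Set Implicit Arguments.
Unset Strict Implicit.
Unset Printing Implicit Defensive.

Import Order.TTheory GRing.Theory Num.Theory.

Local Open Scope classical_set_scope.
Local Open Scope quotient_scope.
Local Open Scope ring_scope.

(* The algType of MathComp excludes the zero ring, which is a legitimate
   R-algebra; hence this presentation by a central structure map. *)
Record algebra (R : comPzRingType) (S : pzRingType) := MkAlgebra {
  alg_map :> {rmorphism R -> S};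
  alg_central : forall (r : R) (a : S), alg_map r * a = a * alg_map r
}.

Section Modules.
Variables (A : pzRingType) (V : lmodType A).

Definition fg_module : Prop :=
  exists (n : nat) (e : 'I_n -> V),
    forall v : V, exists c : 'I_n -> A, v = \sum_(i < n) c i *: e i.

End Modules.

(* A right S-module is a left module over the converse ring S^c. *)
Section RightModules.
Variables (S : pzRingType) (M N : lmodType S^c).

Definition ract (m : M) (a : S) : M := (a : S^c) *: m.

(* The set below always contains 0, so the default value -oo is not used. *)
Definition sur : \bar int :=
  supremum -oo%E
    [set (t%:Z)%:E | t in [set t : nat |
      exists f : {linear M -> {ffun 'I_t -> N}}, forall y, exists x, f x = y]].

End RightModules.

Section RightModuleTheory.
Variables (S : pzRingType) (M : lmodType S^c).
Implicit Types (m : M) (a b : S).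

Lemma ractA m a b : ract (ract m a) b = ract m (a * b).
Proof. by rewrite /ract scalerA. Qed.

Lemma ract1 m : ract m 1 = m.
Proof. exact: scale1r. Qed.

Lemma ractDl m n a : ract (m + n) a = ract m a + ract n a.
Proof. exact: scalerDr. Qed.

Lemma ractDr m a b : ract m (a + b) = ract m a + ract m b.
Proof. exact: scalerDl. Qed.

End RightModuleTheory.

Definition alg_module (R : comPzRingType) (S : pzRingType)
  (phi : algebra R S) : Type := S.

Section AlgebraModule.
Variables (R : comPzRingType) (S : pzRingType) (phi : algebra R S).
Local Notation SR := (alg_module phi).

HB.instance Definition _ := GRing.Zmodule.on SR.

Definition alg_scale (r : R) (a : SR) : SR := phi r * (a : S).

Let alg_scaleA r s (a : SR) :
  alg_scale r (alg_scale s a) = alg_scale (r * s) a.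
Proof. by rewrite /alg_scale mulrA rmorphM. Qed.

Let alg_scale1 : left_id 1 alg_scale.
Proof. by move=> a; rewrite /alg_scale rmorph1 mul1r. Qed.

Let alg_scaleDr : right_distributive alg_scale +%R.
Proof. by move=> r a b; exact: mulrDr. Qed.

Let alg_scaleDl (a : SR) : {morph alg_scale^~ a : r s / r + s}.
Proof. by move=> r s; rewrite /alg_scale rmorphD mulrDl. Qed.

HB.instance Definition _ := GRing.Zmodule_isLmodule.Build R SR
  alg_scaleA alg_scale1 alg_scaleDr alg_scaleDl.

Definition alg_mul (a b : SR) : SR := (a : S) * (b : S).

Lemma alg_mulZl r (a b : SR) : alg_mul (r *: a) b = r *: alg_mul a b.
Proof. by rewrite /alg_mul [LHS]/= -mulrA. Qed.

Lemma alg_mulZr r (a b : SR) : alg_mul a (r *: b) = r *: alg_mul a b.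
Proof.
rewrite /alg_mul [in LHS]/GRing.scale [in RHS]/GRing.scale /= /alg_scale.
by rewrite !mulrA alg_central.
Qed.

End AlgebraModule.

Definition restrict_scalars (R : comPzRingType) (S : pzRingType)
  (phi : algebra R S) (M : lmodType S^c) : Type := M.

Section RestrictScalars.
Variables (R : comPzRingType) (S : pzRingType) (phi : algebra R S).
Variable M : lmodType S^c.
Local Notation MR := (restrict_scalars phi M).

HB.instance Definition _ := GRing.Zmodule.on MR.

Definition restr_scale (r : R) (m : MR) : MR := ract (m : M) (phi r).

Let restr_scaleA a b (m : MR) :
  restr_scale a (restr_scale b m) = restr_scale (a * b) m.
Proof. by rewrite /restr_scale ractA -rmorphM mulrC. Qed.

Let restr_scale1 : left_id 1 restr_scale.
Proof. by move=> m; rewrite /restr_scale rmorph1 ract1. Qed.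

Let restr_scaleDr : right_distributive restr_scale +%R.
Proof. by move=> r m n; exact: ractDl. Qed.

Let restr_scaleDl (m : MR) : {morph restr_scale^~ m : a b / a + b}.
Proof. by move=> a b; rewrite /restr_scale rmorphD ractDr. Qed.

HB.instance Definition _ := GRing.Zmodule_isLmodule.Build R MR
  restr_scaleA restr_scale1 restr_scaleDr restr_scaleDl.

Definition restr_act (m : MR) (a : alg_module phi) : MR := ract (m : M) (a : S).

Lemma restr_actZl (r : R) m a : restr_act (r *: m) a = r *: restr_act m a.
Proof.
rewrite /restr_act [in LHS]/GRing.scale [in RHS]/GRing.scale /= /restr_scale.
by rewrite !ractA alg_central.
Qed.

Lemma restr_actZr (r : R) m a : restr_act m (r *: a) = r *: restr_act m a.
Proof.
rewrite /restr_act [in LHS]/GRing.scale [in RHS]/GRing.scale /= /restr_scale.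
by rewrite !ractA /alg_scale alg_central.
Qed.

End RestrictScalars.

Section Ideals.
Variable R : comPzRingType.
Implicit Types I J : set R.

Definition is_ideal I : Prop :=
  [/\ I 0, forall x y, I x -> I y -> I (x + y) & forall a x, I x -> I (a * x)].

Definition is_prime_ideal I : Prop :=
  [/\ is_ideal I, ~ I 1 & forall x y, I (x * y) -> I x \/ I y].

Definition is_maximal_ideal I : Prop :=
  [/\ is_ideal I, ~ I 1 & forall J, is_ideal J -> ~ J 1 -> I `<=` J -> J = I].

Definition noetherian : Prop :=
  forall I, is_ideal I -> exists (n : nat) (e : 'I_n -> R),
    I = [set x | exists c : 'I_n -> R, x = \sum_(i < n) c i * e i].

End Ideals.

Record Spec (R : comPzRingType) := MkSpec {
  spec_ideal :> set R;
  spec_prime : is_prime_ideal spec_ideal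
}.

HB.instance Definition _ (R : comPzRingType) := gen_eqMixin (Spec R).
HB.instance Definition _ (R : comPzRingType) := gen_choiceMixin (Spec R).

Section Zariski.
Variable R : comPzRingType.

Definition zariski_open (U : set (Spec R)) : Prop :=
  exists E : set R, U = ~` [set p : Spec R | E `<=` p].

Let zariski_openT : zariski_open setT.
Proof.
exists setT; apply/seteqP; split=> // p _ /= /(_ 1 I).
by have [] := spec_prime p.
Qed.

Let zariski_openI : setI_closed zariski_open.
Proof.
move=> _ _ [E ->] [F ->].
exists [set x | exists a b, [/\ E a, F b & x = a * b]].
apply/seteqP; split=> p /=.
  move=> [nE nF] sEF.
  have [_ _ pP] := spec_prime p.
  apply: nE => a Ea; apply: contrapT => npa; apply: nF => b Fb.
  have /pP[] // : spec_ideal p (a * b) by apply: sEF; exists a, b.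
have [[_ _ pM] _ _] := spec_prime p.
move=> nEF; split=> sp; apply: nEF => _ [a [b [Ea Fb ->]]].
  by rewrite mulrC; apply/pM/sp.
exact/pM/sp.
Qed.

Let zariski_open_bigU (I : Type) (f : I -> set (Spec R)) :
  (forall i, zariski_open (f i)) -> zariski_open (\bigcup_i f i).
Proof.
move=> /choice[E fE]; exists (\bigcup_i E i); apply/seteqP; split=> p /=.
  move=> [i _]; rewrite fE /= => nE sE; apply: nE => x Ex.
  by apply: sE; exists i.
move=> nE; apply: contrapT => nf; apply: nE => x [i _ Ex].
by apply: contrapT => npx; apply: nf; exists i => //; rewrite fE /= => /(_ x Ex).
Qed.

HB.instance Definition _ := isOpenTopological.Build (Spec R)
  zariski_openT zariski_openI zariski_open_bigU.

End Zariski.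

Section KrullDimension.

Definition irreducible (T : topologicalType) (Z : set T) : Prop :=
  Z !=set0 /\ forall A B : set T,
    closed A -> closed B -> Z `<=` A `|` B -> Z `<=` A \/ Z `<=` B.

Definition irreducible_chain (T : topologicalType) (n : nat)
    (Z : nat -> set T) : Prop :=
  (forall i, (i <= n)%N -> closed (Z i) /\ irreducible (Z i)) /\
  (forall i, (i < n)%N -> Z i `<` Z i.+1).

(* The dimension of the empty space is -oo, the default value. *)
Definition krull_dim (T : topologicalType) : \bar int :=
  supremum -oo%E
    [set (n%:Z)%:E | n in [set n | exists Z : nat -> set T,
                                     irreducible_chain n Z]].

End KrullDimension.

Section Spectrum.
Variable R : comPzRingType.

Definition jSpec : set (Spec R) :=
  [set p | exists F : set (set R),
     F `<=` is_maximal_ideal (R := R) /\ spec_ideal p = \bigcap_(m in F) m].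

Definition Var (p : Spec R) : set (Spec R) := [set q | p `<=` q].

(* set_type Y carries the topology induced by the inclusion. *)
Definition spec_dim (Y : set (Spec R)) : \bar int := krull_dim (set_type Y).

Definition dim_at (X : set (Spec R)) (p : Spec R) : \bar int :=
  spec_dim (Var p `&` X).

End Spectrum.

Arguments jSpec : clear implicits.

Section Localization.
Variables (R : comPzRingType) (p : Spec R).

Record denom := MkDenom { denom_val :> R; denomP : ~ spec_ideal p denom_val }.

HB.instance Definition _ := gen_eqMixin denom.
HB.instance Definition _ := gen_choiceMixin denom.

Lemma denom1_subproof : ~ spec_ideal p 1.
Proof. by case: (spec_prime p). Qed.
Definition denom1 := MkDenom denom1_subproof.

Lemma denomM_subproof (s t : denom) : ~ spec_ideal p ((s : R) * (t : R)).
Proof.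
have [_ _ pP] := spec_prime p.
by case: s t => s ps [t pt] /= /pP[].
Qed.
Definition denomM s t := MkDenom (@denomM_subproof s t).

Section Module.
Variable V : lmodType R.

Definition loc_rel (x y : V * denom) : bool :=
  `[< exists u : denom,
        (u : R) *: ((y.2 : R) *: x.1) = (u : R) *: ((x.2 : R) *: y.1) >].

Let loc_rel_refl : reflexive loc_rel.
Proof. by move=> x; apply/asboolP; exists denom1. Qed.

Let loc_rel_sym : symmetric loc_rel.
Proof. by move=> x y; apply/asboolP/asboolP => -[u e]; exists u. Qed.

Let loc_rel_trans : transitive loc_rel.
Proof.
move=> [n t] [m s] [k w] /asboolP[/= u eu] /asboolP[/= v ev]; apply/asboolP => /=.
exists (denomM (denomM u v) t) => /=.
transitivity (((v : R) * (w : R)) *: ((u : R) *: ((t : R) *: m))).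
  by rewrite !scalerA; congr (_ *: _); ring.
transitivity (((u : R) * (s : R)) *: ((v : R) *: ((w : R) *: n))).
  by rewrite eu !scalerA; congr (_ *: _); ring.
by rewrite ev !scalerA; congr (_ *: _); ring.
Qed.

Canonical loc_equiv := EquivRel loc_rel loc_rel_refl loc_rel_sym loc_rel_trans.

Definition loc : Type := {eq_quot loc_equiv}.

HB.instance Definition _ := Choice.on loc.
HB.instance Definition _ := EqQuotient.on loc.

Definition frac (v : V) (s : denom) : loc := \pi_loc (v, s).

Lemma frac_eqP v s w t :
  frac v s = frac w t <->
  exists u : denom, (u : R) *: ((t : R) *: v) = (u : R) *: ((s : R) *: w).
Proof. by split=> [/eqmodP/asboolP|e]; last exact/eqmodP/asboolP. Qed.

Lemma fracW (P : loc -> Prop) : (forall v s, P (frac v s)) -> forall x, P x.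
Proof. by move=> Pf x; rewrite -[x]reprK; case: (repr x). Qed.

Lemma frac_repr x : frac (repr x).1 (repr x).2 = x.
Proof. by rewrite -[RHS]reprK; case: (repr x). Qed.

Definition loc_add (x y : loc) : loc :=
  let: (v, s) := repr x in let: (w, t) := repr y in
  frac ((t : R) *: v + (s : R) *: w) (denomM s t).

Definition loc_opp (x : loc) : loc :=
  let: (v, s) := repr x in frac (- v) s.

Lemma loc_addE v s w t :
  loc_add (frac v s) (frac w t) =
  frac ((t : R) *: v + (s : R) *: w) (denomM s t).
Proof.
rewrite /loc_add.
have := frac_repr (frac v s); case: (repr _) => v' s' /= /frac_eqP[a ea].
have := frac_repr (frac w t); case: (repr _) => w' t' /= /frac_eqP[b eb].
apply/frac_eqP; exists (denomM a b) => /=; rewrite !scalerDr; congr (_ + _).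
  transitivity (((b : R) * (t : R) * (t' : R)) *: ((a : R) *: ((s : R) *: v'))).
    by rewrite !scalerA; congr (_ *: _); ring.
  by rewrite ea !scalerA; congr (_ *: _); ring.
transitivity (((a : R) * (s : R) * (s' : R)) *: ((b : R) *: ((t : R) *: w'))).
  by rewrite !scalerA; congr (_ *: _); ring.
by rewrite eb !scalerA; congr (_ *: _); ring.
Qed.

Lemma loc_oppE v s : loc_opp (frac v s) = frac (- v) s.
Proof.
rewrite /loc_opp.
have := frac_repr (frac v s); case: (repr _) => v' s' /= /frac_eqP[a ea].
by apply/frac_eqP; exists a; rewrite !scalerN ea.
Qed.

Let loc_addA : associative loc_add.
Proof.
elim/fracW=> v s; elim/fracW=> w t; elim/fracW=> x u.
rewrite !loc_addE; apply/frac_eqP; exists denom1; congr (_ *: _).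
rewrite /= !scalerDr !scalerA addrA; congr (_ + _ + _); congr (_ *: _); ring.
Qed.

Let loc_addC : commutative loc_add.
Proof.
elim/fracW=> v s; elim/fracW=> w t; rewrite !loc_addE.
apply/frac_eqP; exists denom1; congr (_ *: _).
by rewrite addrC /= (mulrC (s : R)).
Qed.

Let loc_add0 : left_id (frac 0 denom1) loc_add.
Proof.
elim/fracW=> v s; rewrite !loc_addE; apply/frac_eqP; exists denom1.
by congr (_ *: _); rewrite /= scaler0 add0r scale1r mul1r.
Qed.

Let loc_addN : left_inverse (frac 0 denom1) loc_opp loc_add.
Proof.
elim/fracW=> v s; rewrite loc_oppE !loc_addE; apply/frac_eqP; exists denom1.
by congr (_ *: _); rewrite /= scalerN addNr !scaler0.
Qed.

HB.instance Definition _ := GRing.isZmodule.Build loc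
  loc_addA loc_addC loc_add0 loc_addN.

Lemma frac0 s : frac 0 s = 0.
Proof. by apply/frac_eqP; exists denom1; rewrite !scaler0. Qed.

Lemma fracD v s w t :
  frac v s + frac w t = frac ((t : R) *: v + (s : R) *: w) (denomM s t).
Proof. exact: loc_addE. Qed.

End Module.

Section BilinearLift.
Variables (U V W : lmodType R) (b : U -> V -> W).

(* The map (u/s, v/t) |-> b(u,v)/(st). *)
Definition loc_lift2 (x : loc U) (y : loc V) : loc W :=
  let: (u, s) := repr x in let: (v, t) := repr y in frac (b u v) (denomM s t).

Hypothesis bZl : forall r u v, b (r *: u) v = r *: b u v.
Hypothesis bZr : forall r u v, b u (r *: v) = r *: b u v.

Lemma loc_lift2E u s v t :
  loc_lift2 (frac u s) (frac v t) = frac (b u v) (denomM s t).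
Proof.
rewrite /loc_lift2.
have := frac_repr (frac u s); case: (repr _) => u' s' /= /frac_eqP[a ea].
have := frac_repr (frac v t); case: (repr _) => v' t' /= /frac_eqP[c ec].
apply/frac_eqP; exists (denomM a c) => /=.
transitivity (b ((a : R) *: ((s : R) *: u')) ((c : R) *: ((t : R) *: v'))).
  by rewrite !(bZl, bZr) !scalerA; congr (_ *: _); ring.
by rewrite ea ec !(bZl, bZr) !scalerA; congr (_ *: _); ring.
Qed.

Hypothesis bDl : forall u u' v, b (u + u') v = b u v + b u' v.
Hypothesis bDr : forall u v v', b u (v + v') = b u v + b u v'.

Lemma loc_lift2Dl x x' y :
  loc_lift2 (x + x') y = loc_lift2 x y + loc_lift2 x' y.
Proof.
elim/fracW: x => u s; elim/fracW: x' => u' s'; elim/fracW: y => v t.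
rewrite !(fracD, loc_lift2E); apply/frac_eqP; exists denom1; congr (_ *: _).
rewrite /= bDl !bZl !scalerDr !scalerA; congr (_ *: _ + _ *: _); ring.
Qed.

Lemma loc_lift2Dr x y y' :
  loc_lift2 x (y + y') = loc_lift2 x y + loc_lift2 x y'.
Proof.
elim/fracW: x => u s; elim/fracW: y => v t; elim/fracW: y' => v' t'.
rewrite !(fracD, loc_lift2E); apply/frac_eqP; exists denom1; congr (_ *: _).
rewrite /= bDr !bZr !scalerDr !scalerA; congr (_ *: _ + _ *: _); ring.
Qed.

End BilinearLift.
End Localization.

Definition loc_ring (R : comPzRingType) (p : Spec R) (S : pzRingType)
  (phi : algebra R S) : Type := loc p (alg_module phi).

Section LocalizedRing.
Variables (R : comPzRingType) (p : Spec R) (S : pzRingType) (phi : algebra R S).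
Local Notation Sp := (loc_ring p phi).
Local Notation fr a s := (frac (a : alg_module phi) s : Sp).

HB.instance Definition _ := GRing.Zmodule.on Sp.

Definition loc_one : Sp := fr (1 : S) (denom1 p).
Definition loc_mul : Sp -> Sp -> Sp := loc_lift2 (@alg_mul R S phi).

Lemma loc_mulE (a b : S) s t :
  loc_mul (fr a s) (fr b t) = fr (a * b) (denomM s t).
Proof. exact: (loc_lift2E (@alg_mulZl _ _ phi) (@alg_mulZr _ _ phi)). Qed.

Let loc_mulA : associative loc_mul.
Proof.
elim/fracW=> a s; elim/fracW=> b t; elim/fracW=> c u; rewrite !loc_mulE.
apply/frac_eqP; exists (denom1 p); rewrite /= mulrA; congr (_ *: (_ *: _)); ring.
Qed.

Let loc_mul1l : left_id loc_one loc_mul.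
Proof.
elim/fracW=> a s; rewrite loc_mulE; apply/frac_eqP; exists (denom1 p).
by rewrite /= !mul1r.
Qed.

Let loc_mul1r : right_id loc_one loc_mul.
Proof.
elim/fracW=> a s; rewrite loc_mulE; apply/frac_eqP; exists (denom1 p).
by rewrite /= !mulr1.
Qed.

Let loc_mulDl : left_distributive loc_mul +%R.
Proof.
move=> x y z; apply: loc_lift2Dl.
- exact: alg_mulZl.
- exact: alg_mulZr.
- by move=> a b c; exact: mulrDl.
Qed.

Let loc_mulDr : right_distributive loc_mul +%R.
Proof.
move=> x y z; apply: loc_lift2Dr.
- exact: alg_mulZl.
- exact: alg_mulZr.
- by move=> a b c; exact: mulrDr.
Qed.

HB.instance Definition _ := GRing.Zmodule_isPzRing.Build Sp
  loc_mulA loc_mul1l loc_mul1r loc_mulDl loc_mulDr.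

End LocalizedRing.

Definition loc_module (R : comPzRingType) (p : Spec R) (S : pzRingType)
  (phi : algebra R S) (M : lmodType S^c) : Type :=
  loc p (restrict_scalars phi M).

Section LocalizedModule.
Variables (R : comPzRingType) (p : Spec R) (S : pzRingType) (phi : algebra R S).
Variable M : lmodType S^c.
Local Notation Sp := (loc_ring p phi).
Local Notation Mp := (loc_module p phi M).

HB.instance Definition _ := GRing.Zmodule.on Mp.

Definition loc_scale (a : Sp^c) (x : Mp) : Mp :=
  loc_lift2 (@restr_act R S phi M) x a.

Lemma loc_scaleE (a : S) s (m : M) t :
  loc_scale (frac (a : alg_module phi) s) (frac (m : restrict_scalars phi M) t)
  = frac (ract m a : restrict_scalars phi M) (denomM t s).
Proof. exact: (loc_lift2E (@restr_actZl _ _ phi M) (@restr_actZr _ _ phi M)). Qed.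

Let loc_scaleA (a b : Sp^c) x : loc_scale a (loc_scale b x) = loc_scale (a * b) x.
Proof.
elim/fracW: a => a s; elim/fracW: b => b t; elim/fracW: x => m u.
rewrite [_ * _]loc_mulE !loc_scaleE ractA.
apply/frac_eqP; exists (denom1 p) => /=; congr (_ *: (_ *: _)); ring.
Qed.

Let loc_scale1 : left_id 1 loc_scale.
Proof.
elim/fracW=> m s; rewrite loc_scaleE ract1; apply/frac_eqP.
by exists (denom1 p); rewrite /= mulr1.
Qed.

Let loc_scaleDr : right_distributive loc_scale +%R.
Proof.
move=> a x y; apply: loc_lift2Dl.
- exact: restr_actZl.
- exact: restr_actZr.
- by move=> m n b; exact: ractDl.
Qed.

Let loc_scaleDl x : {morph loc_scale^~ x : a b / a + b}.
Proof.
move=> a b; apply: loc_lift2Dr.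
- exact: restr_actZl.
- exact: restr_actZr.
- by move=> m c d; exact: ractDr.
Qed.

HB.instance Definition _ := GRing.Zmodule_isLmodule.Build Sp^c Mp
  loc_scaleA loc_scale1 loc_scaleDr loc_scaleDl.

End LocalizedModule.

Definition Supp (R : comPzRingType) (S : pzRingType) (phi : algebra R S)
  (N : lmodType S^c) : set (Spec R) :=
  [set p | exists x : loc_module p phi N, x != 0].

(* Main.v *)
(* Choose generators f_1, ..., f_n of Hom_S(M, N) over R. For a family of linear
   combinations of the f_i, let its capacity at p be the largest k such that some
   k R-linear combinations of the family form a map M -> N^k that is surjective
   at p. As in the Eisenbud-Evans theory of basic elements, the family is shortened
   one member at a time by elementary operations, keeping the capacity at every p
   in X at least min(n, t + dim_X(p)) for a family of length n. Dropping a member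
   costs at most 1 everywhere; at the finitely many generic points of the loci
   {p in X : capacity <= k}, k < n, the operations are chosen so that it costs
   nothing, and at any other point the excess dimension of the generic point below
   it pays for the loss. A family of length t is then surjective at every p in X,
   hence at every maximal ideal.

   Surjectivity at p is the non-vanishing mod p of a determinant, so that along a
   line of combinations it is a polynomial condition over R/p; this replaces the
   passage to residue fields, and covers finite residue fields as well. *)

Require Import Defs.
From HB Require Import structures.
From mathcomp Require Import all_boot all_order all_algebra.
From mathcomp Require Import generic_quotient ring_quotient.
From mathcomp Require Import all_classical.
From mathcomp Require Import constructive_ereal topology.

Set Implicit Arguments.
Unset Strict Implicit.
Unset Printing Implicit Defensive.

Import Order.TTheory GRing.Theory Num.Theory.

Local Open Scope classical_set_scope.
Local Open Scope ring_scope.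

(** * The domain R/p *)

(** Linear algebra mod p is done over R/p, which has to be an [idomainType] for the results on
    determinants and roots; properness of p gives [1 != 0]. *)
Lemma prime_quotient (R : comPzRingType) (p : Spec R) :
  exists (D : idomainType) (f : {rmorphism R -> D}),
    (forall x, f x = 0 <-> spec_ideal p x) /\ (forall y, exists x, f x = y).
Proof.
have [[p0 pD pM] p1 pP] := spec_prime p.
have R10 : (1 : R) != 0 by apply/eqP => h; apply: p1; rewrite h.
pose R1 : comNzRingType := HB.pack (R : Type) R
  (GRing.PzSemiRing_isNonZero.Build R R10).
pose I : R1 -> bool := fun x => `[< spec_ideal p x >].
have idI : idealr_closed I.
  split.
  - exact/asboolP.
  - by apply/negP => /asboolP.
  - by move=> a u v /asboolP pu /asboolP pv; apply/asboolP/pD => //; apply: pM.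
pose idealI : idealr R1 := HB.pack I (isIdealr.Build R1 I idI).
have prI : prime_idealr_closed idealI.
  by move=> u v /asboolP/pP[] h; apply/orP; [left|right]; exact/asboolP.
pose primeI : prime_idealr R1 := HB.pack I idealI (isPrimeIdealrClosed.Build R1 I prI).
pose Q : comNzRingType := {ideal_quot primeI}.
(* An [idomainType] carries an inverse function: it is chosen classically on the units and is the
   identity elsewhere. *)
pose un : pred Q := fun x => `[< exists y, y * x = 1 >].
pose iv : Q -> Q := fun x => xget x [set y | y * x = 1].
have ivl : {in un, left_inverse 1 iv *%R}.
  move=> x /asboolP[y yx]; rewrite /iv; case: xgetP => [z _ //|].
  by move=> /(_ y) /=.
have unP (x y : Q) : y * x = 1 -> un x by move=> h; apply/asboolP; exists y.
have ivo : {in [predC un], iv =1 id}.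
  move=> x /negP nx; rewrite /iv; case: xgetP => // z _ /unP.
  by move=> h; case: nx.
pose D1 : comUnitRingType := HB.pack (Q : Type) Q
   (GRing.ComNzRing_hasMulInverse.Build Q ivl unP ivo).
have dom : GRing.integral_domain_axiom D1.
  by move=> x y; exact: (@Quotient.rquot_IdomainAxiom R1 primeI).
pose D : idomainType := HB.pack (Q : Type) D1
  (GRing.ComUnitRing_isIntegral.Build D1 dom).
pose f : {rmorphism R1 -> {ideal_quot primeI}} := \pi_({ideal_quot primeI})%qT.
have f0 x : f x = 0 <-> spec_ideal p x.
  rewrite -(rmorph0 f); split => [/eqP|px].
    by rewrite -Quotient.idealrBE subr0 => /asboolP.
  by apply/eqP; rewrite -Quotient.idealrBE subr0; exact/asboolP.
exists D, f; split=> // y; exists (repr y); exact: reprK.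
Qed.

Section PrimeLinearAlgebra.
Variables (R : comPzRingType) (p : Spec R).
Local Notation P := (spec_ideal p).

(** The determinant is a polynomial in the parameter over R/p, nonzero because its value at c is. If
    c is not itself a multiple of u mod p, then u is not a unit there, its powers are distinct, and
    one of them is not a root. *)
Lemma det_affine_avoid m (A B : 'M[R]_m) (c u : R) :
  ~ P (\det (A + c *: B)) -> ~ P u ->
  exists d, ~ P (\det (A + (u * d) *: B)).
Proof.
have [D [f [f0 fsurj]]] := prime_quotient p.
pose q : {poly D} :=
  \det (map_mx polyC (map_mx f A) + 'X *: map_mx polyC (map_mx f B)).
have qE x : q.[f x] = f (\det (A + x *: B)).
  rewrite -[LHS]/(horner_eval (f x) q) -!det_map_mx; congr (\det _).
  apply/matrixP => i j; rewrite !mxE /= /horner_eval.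
  by rewrite hornerD hornerM hornerX !hornerC rmorphD rmorphM.
move=> /f0/eqP; rewrite -qE => qc /f0/eqP fu.
have q0 : q != 0 by apply: contraNneq qc => ->; rewrite horner0.
have [[d]|nd] := pselect (exists d, f (u * d) = f c).
  by move=> ud; exists d => /f0/eqP; rewrite -qE ud (negPf qc).
have injX : injective (fun i => f u ^+ i).
  move=> i j; wlog lt_ij : i j / (i < j)%N.
    by move=> wl h; case: (ltngtP i j) => // ij; [exact: wl|symmetry; exact: wl].
  rewrite -(subnKC lt_ij) exprD exprS -{1}[f u ^+ i]mul1r mulrAC => /eqP.
  rewrite -subr_eq0 -mulrBl mulf_eq0 expf_eq0 (negPf fu) andbF orbF subr_eq0.
  move=> /eqP e; case: nd; exists (u ^+ (j - i.+1) * c).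
  by rewrite !rmorphM rmorphXn mulrA -e mul1r.
(* [size q] distinct points cannot all be roots; exponents start at 1 so that every point is a
   multiple of u. *)
have : ~~ all (root q) [seq f u ^+ i.+1 | i <- iota 0 (size q)].
  apply/negP => allq; suff: (size q < size q)%N by rewrite ltnn.
  rewrite -{1}(size_iota 0 (size q)) -(size_map (fun i => f u ^+ i.+1)).
  apply: max_poly_roots => //; rewrite map_inj_uniq ?iota_uniq //.
  by move=> i j /injX[].
move=> /allPn[_ /mapP[i _ ->]] nr; exists (u ^+ i) => /f0/eqP.
by rewrite -qE -exprS rmorphXn; exact/negP.
Qed.

(** As k < n, the transpose of V padded with zero columns is a square matrix of determinant zero
    over R/p; a vector of its left kernel lifts to R. *)
Lemma ker_col_mod_prime k n (V : 'M[R]_(k, n)) : (k < n)%N ->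
  exists w : 'cV[R]_n, (exists i, ~ P (w i 0)) /\ forall j, P ((V *m w) j 0).
Proof.
have [D [f [f0 fsurj]]] := prime_quotient p.
move=> lt_kn.
pose A : 'M[D]_n := \matrix_(j, i) oapp (fun i' => f (V i' j)) 0 (insub (val i)).
have : \det A == 0.
  rewrite -det_tr; apply/det0P; exists (delta_mx 0 (Ordinal lt_kn)).
    by apply/eqP => /matrixP/(_ 0 (Ordinal lt_kn)); rewrite !mxE !eqxx;
      exact/eqP/oner_neq0.
  rewrite -rowE; apply/rowP => j; rewrite !mxE.
  by case: insubP => //= i' lt_i ei; have := ltn_ord i'; rewrite ei ltnn.
move=> /det0P[v v0 vA].
have /choice[w wE] j : exists x, f x = v 0 j by [].
exists (\col_j w j); split.
  have /existsP[i] : [exists i, v 0 i != 0].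
    by apply: contraNT v0; rewrite negb_exists => /forallP h; apply/eqP/rowP => i;
       rewrite mxE; apply/eqP/negPn.
  by move=> vi; exists i; rewrite mxE => /f0; rewrite wE; exact/eqP.
move=> j; apply/f0; rewrite mxE rmorph_sum.
have /rowP/(_ (widen_ord (ltnW lt_kn) j)) := vA; rewrite !mxE => vA0; rewrite -[RHS]vA0.
apply: eq_bigr => i _; rewrite mxE rmorphM wE mulrC mxE; congr (_ * _).
by case: insubP => [i' _ /= ei|]; [congr (f (V _ _)); apply/val_inj|rewrite /= ltn_ord].
Qed.

Lemma ker_row_mod_prime n (V : 'M[R]_n) : P (\det V) ->
  exists w : 'rV[R]_n, (exists i, ~ P (w 0 i)) /\ forall j, P ((w *m V) 0 j).
Proof.
have [D [f [f0 fsurj]]] := prime_quotient p.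
move=> /f0; rewrite -det_map_mx => /eqP/det0P[v v0 vA].
have /choice[w wE] j : exists x, f x = v 0 j by [].
exists (\row_j w j); split.
  have /existsP[i] : [exists i, v 0 i != 0].
    by apply: contraNT v0; rewrite negb_exists => /forallP h; apply/eqP/rowP => i;
       rewrite mxE; apply/eqP/negPn.
  by move=> vi; exists i; rewrite mxE => /f0; rewrite wE; exact/eqP.
move=> j; apply/f0; rewrite mxE rmorph_sum.
have /rowP/(_ j) := vA; rewrite !mxE => vA0; rewrite -[RHS]vA0.
by apply: eq_bigr => i _; rewrite !mxE rmorphM wE.
Qed.

Lemma det_mod_prime m (A B : 'M[R]_m) :
  (forall i j, P (A i j - B i j)) -> P (\det A) -> P (\det B).
Proof.
have [D [f [f0 fsurj]]] := prime_quotient p.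
move=> AB /f0 h; apply/f0; rewrite -h -!det_map_mx; congr (\det _).
apply/matrixP => i j; rewrite !mxE; apply/eqP.
by rewrite eq_sym -subr_eq0 -rmorphB; apply/eqP/f0.
Qed.

End PrimeLinearAlgebra.

(** * Noetherian rings *)

Section NoetherianModules.
Variable R : comPzRingType.
Hypothesis noethR : noetherian R.

Definition is_submodule (V : lmodType R) (L : set V) : Prop :=
  [/\ L 0, forall x y, L x -> L y -> L (x + y) & forall a x, L x -> L (a *: x)].

Lemma submodule_sum (V : lmodType R) (L : set V) (I : finType) (c : I -> R)
  (e : I -> V) :
  is_submodule L -> (forall i, L (e i)) -> L (\sum_i c i *: e i).
Proof.
by move=> [L0 LD LZ] Le; apply: (big_ind L) => // i _; exact: LZ.
Qed.

Definition fg_submodule (V : lmodType R) (L : set V) : Prop :=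
  exists (n : nat) (e : 'I_n -> V), (forall i, L (e i)) /\
    forall v, L v -> exists c : 'I_n -> R, v = \sum_(i < n) c i *: e i.

(** Induction on m: the first coordinates of L form an ideal, whose generators lift to L;
    subtracting a combination of the lifts leaves an element with first coordinate 0, that is, one
    of a submodule of ['rV_m]. *)
Lemma fg_submodule_rV m (L : set 'rV[R]_m) : is_submodule L -> fg_submodule L.
Proof.
elim: m L => [|m IHm] => [L _|].
  exists 0%N, (fun i : 'I_0 => 0); split=> [[]//|v _]; exists (fun=> 0).
  by rewrite big_ord0 [v]thinmx0.
rewrite -(add1n m) => L subL; have [L0 LD LZ] := subL.
have LN v : L v -> L (- v) by move=> Lv; rewrite -scaleN1r; exact: LZ.
pose I : set R := [set x | exists2 v, L v & v 0 0 = x].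
have [] : is_ideal I.
  split=> [|_ _ [v Lv <-] [w Lw <-]|a _ [v Lv <-]].
  - by exists 0; rewrite ?mxE.
  - by exists (v + w); [exact: LD|rewrite mxE].
  - by exists (a *: v); [exact: LZ|rewrite mxE].
move=> I0 ID IM; have [|n1 [a Ia]] := noethR (I := I); first by split.
have /choice[v vP] i : exists v, L v /\ v 0 0 = a i.
  have : I (a i).
    rewrite Ia; exists (fun j => (j == i)%:R); rewrite (bigD1 i) //= eqxx mul1r.
    by rewrite big1 ?addr0 // => j /negPf ->; rewrite mul0r.
  by move=> [v ? ?]; exists v.
pose L' : set 'rV[R]_m := [set w | L (row_mx (0 : 'rV_1) w)].
have [|n2 [w [L'w wspan]]] := IHm L'.
  split; rewrite /L' /=.
  - by rewrite row_mx0.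
  - by move=> x y Lx Ly; have := LD _ _ Lx Ly; rewrite add_row_mx addr0.
  - by move=> b x Lx; have := LZ b _ Lx; rewrite scale_row_mx scaler0.
pose e (i : 'I_(n1 + n2)) : 'rV[R]_(1 + m) := match fintype.split i with
  | inl i => v i | inr i => row_mx (0 : 'rV_1) (w i) end.
exists (n1 + n2)%N, e; split.
  by move=> i; rewrite /e; case: (fintype.split i) => j; [case: (vP j)|exact: L'w].
move=> x Lx.
have [c xc] : exists c : 'I_n1 -> R, x 0 0 = \sum_(i < n1) c i * a i.
  by have : I (x 0 0) by [exists x]; rewrite Ia.
have [y ydef] : {y | y = x - \sum_i c i *: v i} by exists (x - \sum_i c i *: v i).
have Ly : L y.
  rewrite ydef; apply: LD => //; apply: LN; apply: submodule_sum => [//|i].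
  by case: (vP i).
have y0 : y 0 0 = 0.
  rewrite ydef !mxE summxE xc -sumrB big1 // => i _.
  by rewrite mxE; case: (vP i) => _ ->; rewrite subrr.
have yE : y = row_mx (0 : 'rV_1) (rsubmx y).
  rewrite -[LHS](hsubmxK y); congr row_mx.
  apply/rowP => i; rewrite ord1 !mxE -[RHS]y0; congr (fun_of_matrix y _ _); exact/val_inj.
have [d yd] : exists d : 'I_n2 -> R,
    rsubmx y = \sum_(i < n2) d i *: w i.
  by apply: wspan; rewrite /L' /= -yE.
exists (fun i => match fintype.split i with inl i => c i | inr i => d i end).
rewrite big_split_ord /=.
rewrite (eq_bigr (fun i => c i *: v i)) => [|i _]; last first.
  by rewrite /e (unsplitK (inl i)).
rewrite [X in _ + X](eq_bigr (fun i => row_mx (0 : 'rV_1) (d i *: w i))) => [|i _]; last first.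
  by rewrite /e (unsplitK (inr i)) scale_row_mx scaler0.
suff -> : \sum_(i < n2) row_mx (0 : 'rV_1) (d i *: w i) = y.
  by rewrite ydef addrC subrK.
rewrite yE yd; elim/big_rec2: _ => [|i z t _ ->]; first by rewrite row_mx0.
by rewrite add_row_mx addr0.
Qed.

(** Generators present V as a quotient of R^b; the preimage of L is finitely generated there, and
    its generators map to generators of L. *)
Lemma fg_submodule_noetherian (V : lmodType R) (L : set V) :
  fg_module V -> is_submodule L -> fg_submodule L.
Proof.
move=> [b [e eV]] [L0 LD LZ].
pose F (y : 'rV[R]_b) := \sum_j y 0 j *: e j.
have FD y z : F (y + z) = F y + F z.
  by rewrite /F -big_split /=; apply: eq_bigr => j _; rewrite mxE scalerDl.
have FZ a y : F (a *: y) = a *: F y.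
  by rewrite /F scaler_sumr; apply: eq_bigr => j _; rewrite mxE scalerA.
have F0 : F 0 = 0 by rewrite /F big1 // => j _; rewrite mxE scale0r.
have [|n [y [Ly ys]]] := @fg_submodule_rV b [set y | L (F y)].
  split=> /=.
  - by rewrite F0.
  - by move=> y z; rewrite FD; exact: LD.
  - by move=> a y; rewrite FZ; exact: LZ.
exists n, (fun i => F (y i)); split=> // v Lv.
have [c vc] := eV v.
have vF : v = F (\row_j c j) by rewrite vc /F; apply: eq_bigr => j _; rewrite mxE.
have [|d dE] := ys (\row_j c j); first by rewrite /= -vF.
exists d; rewrite vF dE; elim/big_rec2: _ => [|i z t _ <-]; first exact: F0.
by rewrite FD FZ.
Qed.

Lemma fg_module_matrix m n : fg_module 'M[R]_(m, n).
Proof.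
exists (m * n)%N, (fun k => vec_mx (delta_mx 0 k)) => v.
exists (fun k => mxvec v 0 k); rewrite -[LHS]mxvecK {1}[mxvec v]row_sum_delta.
by rewrite linear_sum; apply: eq_bigr => k _; rewrite linearZ.
Qed.

(** A counterexample would start a strictly increasing sequence of counterexamples; the generators
    of its union all lie in one member, where the sequence would have to stop. *)
Lemma noetherian_ind (P : set R -> Prop) :
  (forall I, is_ideal I ->
     (forall J, is_ideal J -> I `<=` J -> ~ J `<=` I -> P J) -> P I) ->
  forall I, is_ideal I -> P I.
Proof.
move=> step I0 idI0; apply: contrapT => nPI0.
pose bad := {I : set R | is_ideal I /\ ~ P I}.
have /choice[next nextP] (I : bad) :
    exists J : bad, sval I `<=` sval J /\ ~ sval J `<=` sval I.
  case: I => I [idI nPI] /=; apply: contrapT => nJ; apply/nPI/step => //.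
  move=> J idJ IJ nJI; apply: contrapT => nPJ; apply: nJ.
  by exists (exist _ J (conj idJ nPJ)).
pose C n := sval (iter n next (exist _ I0 (conj idI0 nPI0) : bad)).
have idC n : is_ideal (C n) by rewrite /C; case: (iter _ _ _) => ? [].
have leC m n : (m <= n)%N -> C m `<=` C n.
  elim: n => [|n IHn]; first by rewrite leqn0 => /eqP ->.
  rewrite leq_eqVlt => /orP[/eqP->//|/IHn mn].
  apply: subset_trans mn _.
  by case: (nextP (iter n next (exist _ I0 (conj idI0 nPI0) : bad))).
have [|n [e eU]] := noethR (I := \bigcup_n C n).
  split.
  - by exists 0%N => //; case: (idC 0%N).
  - move=> x y [i _ Cx] [j _ Cy]; exists (maxn i j) => //.
    by case: (idC (maxn i j)) => _ + _; apply;
      [exact: (leC _ _ (leq_maxl i j) _ Cx)|exact: (leC _ _ (leq_maxr i j) _ Cy)].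
  - by move=> a x [i _ Cx]; exists i => //; case: (idC i) => _ _; apply.
have /choice[k kP] i : exists k, C k (e i).
  have : (\bigcup_n C n) (e i).
    rewrite eU; exists (fun j => (j == i)%:R); rewrite (bigD1 i) //= eqxx mul1r.
    by rewrite big1 ?addr0 // => j /negPf ->; rewrite mul0r.
  by move=> [m _ Cm]; exists m.
pose K := (\max_i k i)%N.
case: (nextP (iter K next (exist _ I0 (conj idI0 nPI0) : bad))) => _; apply.
rewrite -[X in X `<=` _]/(C K.+1) -[X in _ `<=` X]/(C K) => x Cx.
have : (\bigcup_n C n) x by exists K.+1.
rewrite eU => -[c ->]; have [C0 CD CM] := idC K.
apply: (big_ind (C K)) => // i _; apply: CM.
exact: (leC _ _ (leq_bigmax i) _ (kP i)).
Qed.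

Lemma exists_maximal_ideal (I : set R) : is_ideal I -> ~ I 1 ->
  exists2 m, is_maximal_ideal m & I `<=` m.
Proof.
move: I.
apply: (noetherian_ind (P := fun I => ~ I 1 -> exists2 m, is_maximal_ideal m & I `<=` m)).
move=> I idI IH I1.
have [[J [idJ J1 IJ nJI]]|nJ] :=
    pselect (exists J, [/\ is_ideal J, ~ J 1, I `<=` J & ~ J `<=` I]).
  have [m mm Jm] := IH J idJ IJ nJI J1.
  by exists m => //; exact: subset_trans Jm.
exists I => //; split=> // J idJ J1 IJ; apply/seteqP; split=> //.
by apply: contrapT => nJI; apply: nJ; exists J.
Qed.

Lemma ideal_adjoin (I : set R) (x : R) : is_ideal I ->
  is_ideal [set z | exists2 a, I a & exists r, z = a + r * x].
Proof.
move=> [I0 ID IM]; split=> /=.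
- by exists 0 => //; exists 0; rewrite mul0r addr0.
- move=> _ _ [a Ia [r ->]] [b Ib [s ->]]; exists (a + b); first exact: ID.
  by exists (r + s); rewrite mulrDl addrACA.
- move=> c _ [a Ia [r ->]]; exists (c * a); first exact: IM.
  by exists (c * r); rewrite mulrDr mulrA.
Qed.

Lemma maximal_ideal_prime (m : set R) : is_maximal_ideal m -> is_prime_ideal m.
Proof.
move=> [idm m1 mmax]; split=> // x y mxy.
have [m0 mD mM] := idm.
have [mx|nmx] := pselect (m x); [by left|right].
have [[a ma [r e1]]|n1] :=
    pselect (exists2 a, m a & exists r, 1 = a + r * x).
  rewrite -[y]mulr1 e1 mulrDr; apply: mD; first exact: mM.
  by rewrite mulrCA; apply: mM; rewrite mulrC.
case: nmx; rewrite -(mmax _ (ideal_adjoin x idm)) //=.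
  by exists 0 => //; exists 1; rewrite add0r mul1r.
by move=> a ma; exists a => //; exists 0; rewrite mul0r addr0.
Qed.

Lemma bigcap_ideal (F : set (set R)) : F `<=` @is_ideal R ->
  is_ideal (\bigcap_(I in F) I).
Proof.
move=> idF; split=> [I FI|x y Fx Fy I FI|a x Fx I FI];
  have [I0 ID IM] := idF I FI => //.
- by apply: ID; [exact: Fx|exact: Fy].
- by apply: IM; exact: Fx.
Qed.

(* For closed [X], these are the generic points of the components of V(E) in X. *)
Lemma generic_points (X : set (Spec R)) :
  (forall (F : set (Spec R)) (p : Spec R), F `<=` X ->
     spec_ideal p = \bigcap_(q in F) spec_ideal q -> X p) ->
  forall E : set R, exists ps : seq (Spec R),
    (forall p, p \in ps -> X p /\ E `<=` spec_ideal p) /\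
    forall q, X q -> E `<=` spec_ideal q ->
      exists2 p, p \in ps & spec_ideal p `<=` spec_ideal q.
Proof.
move=> capX.
have red (E : set R) : is_ideal
    (\bigcap_(q in [set q | X q /\ E `<=` spec_ideal q]) spec_ideal q).
  have -> : \bigcap_(q in [set q | X q /\ E `<=` spec_ideal q]) spec_ideal q
    = \bigcap_(I in [set spec_ideal q | q in [set q | X q /\ E `<=` spec_ideal q]]) I.
    by rewrite bigcap_image.
  by apply: bigcap_ideal => _ [q _ <-]; case: (spec_prime q).
have sub (E : set R) :
    E `<=` \bigcap_(q in [set q | X q /\ E `<=` spec_ideal q]) spec_ideal q.
  by move=> x Ex q [_]; apply.
have ideals : forall I, is_ideal I -> exists ps : seq (Spec R),
    (forall p, p \in ps -> X p /\ I `<=` spec_ideal p) /\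
    forall q, X q -> I `<=` spec_ideal q ->
      exists2 p, p \in ps & spec_ideal p `<=` spec_ideal q.
  apply: noetherian_ind => I idI IH.
  (* J has the same primes of X above it as I, so the induction hypothesis applies if J is strictly
     larger. Otherwise I equals J, and if it is also prime, then [capX] makes it a point of X. *)
  pose J := \bigcap_(q in [set q | X q /\ I `<=` spec_ideal q]) spec_ideal q.
  have [JI|nJI] := pselect (J `<=` I); last first.
    have [ps [psX psq]] := IH J (red I) (sub I) nJI.
    exists ps; split.
      by move=> p /psX[Xp Jp]; split=> //; exact: subset_trans (sub I) Jp.
    by move=> q Xq Iq; apply: psq => // x; exact.
  have eIJ : I = J by apply/seteqP; split=> //; exact: sub.
  have [I1|nI1] := pselect (I 1).
    exists [::]; split=> // q _ /(_ _ I1) q1.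
    by case: (spec_prime q).
  have [prI|] := pselect (forall x y, I (x * y) -> I x \/ I y).
    have pI : is_prime_ideal I by split.
    exists [:: MkSpec pI]; split.
      move=> p; rewrite inE => /eqP ->; split=> //=.
      apply: (capX [set q | X q /\ I `<=` spec_ideal q]) => //.
      by move=> q [].
    by move=> q Xq Iq; exists (MkSpec pI) => //; rewrite inE.
  (* I is not prime: a point of X above it contains x or y, and adjoining either to I gives a
     strictly larger ideal. *)
  move=> /existsNP[x /existsNP[y /not_implyP[Ixy /not_orP[nIx nIy]]]].
  have adj z : ~ I z -> exists ps : seq (Spec R),
    (forall p, p \in ps -> X p /\ I `<=` spec_ideal p) /\
    forall q, X q -> I `<=` spec_ideal q -> spec_ideal q z ->
      exists2 p, p \in ps & spec_ideal p `<=` spec_ideal q.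
    move=> nIz; have [I0 _ _] := idI.
    have sI : I `<=` [set t | exists2 a, I a & exists r, t = a + r * z].
      by move=> a Ia; exists a => //; exists 0; rewrite mul0r addr0.
    have [||ps [psX psq]] := IH _ (ideal_adjoin z idI) => //.
      by move=> h; apply/nIz/h; exists 0 => //; exists 1; rewrite add0r mul1r.
    exists ps; split=> [p /psX[Xp zp]|q Xq Iq qz].
      by split=> //; exact: subset_trans zp.
    apply: psq => // _ [a Ia [r ->]]; have [[_ qD qM] _ _] := spec_prime q.
    by apply: qD; [exact: Iq|exact: qM].
  have [ps1 [ps1X ps1q]] := adj x nIx; have [ps2 [ps2X ps2q]] := adj y nIy.
  exists (ps1 ++ ps2); split=> [p|q Xq Iq].
    by rewrite mem_cat => /orP[/ps1X|/ps2X].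
  have [_ _ /(_ _ _ (Iq _ Ixy)) qP] := spec_prime q.
  case: qP => [/(ps1q q Xq Iq)|/(ps2q q Xq Iq)] [p pps pq];
    by exists p; rewrite // mem_cat pps ?orbT.
move=> E; have [ps [psX psq]] := ideals _ (red E).
exists ps; split=> [p /psX[Xp Jp]|q Xq Eq].
  by split=> //; exact: subset_trans (sub E) Jp.
by apply: psq => // x; exact.
Qed.

End NoetherianModules.

(** * Capacity of a family of maps at a prime *)

Section PrimeFacts.
Variables (R : comPzRingType) (p : Spec R).
Local Notation P := (spec_ideal p).

Lemma prime0 : P 0. Proof. by case: (spec_prime p) => -[]. Qed.

Lemma primeD x y : P x -> P y -> P (x + y).
Proof. by case: (spec_prime p) => -[_ + _] _ _; apply. Qed.

Lemma primeMl a x : P x -> P (a * x).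
Proof. by case: (spec_prime p) => -[_ _ +] _ _; apply. Qed.

Lemma primeMr a x : P x -> P (x * a).
Proof. by rewrite mulrC; exact: primeMl. Qed.

Lemma primeN x : P x -> P (- x).
Proof. by rewrite -mulN1r; exact: primeMl. Qed.

Lemma prime1 : ~ P 1. Proof. by case: (spec_prime p). Qed.

Lemma nprimeM x y : ~ P x -> ~ P y -> ~ P (x * y).
Proof. by case: (spec_prime p) => _ _ pP nx ny /pP[]. Qed.

Lemma nprimeX x n : ~ P x -> ~ P (x ^+ n).
Proof.
by move=> nx; elim: n => [|n IH]; rewrite ?exprS; [exact: prime1|exact: nprimeM].
Qed.

Lemma prime_sum (I : finType) (F : I -> R) : (forall i, P (F i)) -> P (\sum_i F i).
Proof. by move=> PF; apply: (big_ind P) => //; [exact: prime0|exact: primeD]. Qed.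

Lemma nprime_prod (I : finType) (F : I -> R) :
  (forall i, ~ P (F i)) -> ~ P (\prod_i F i).
Proof.
by move=> PF; apply: (big_ind (fun x => ~ P x)) => //; [exact: prime1|exact: nprimeM].
Qed.

Lemma prime_mulmx m n k (A : 'M[R]_(m, n)) (B : 'M[R]_(n, k)) :
  (forall i j, P (A i j)) -> forall i j, P ((A *m B) i j).
Proof. by move=> PA i j; rewrite mxE; apply: prime_sum => l; exact: primeMr. Qed.

Lemma prime_mulmxr m n k (A : 'M[R]_(m, n)) (B : 'M[R]_(n, k)) :
  (forall i j, P (B i j)) -> forall i j, P ((A *m B) i j).
Proof. by move=> PB i j; rewrite mxE; apply: prime_sum => l; exact: primeMl. Qed.

End PrimeFacts.

Lemma Spec_inj (R : comPzRingType) (p q : Spec R) :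
  spec_ideal p = spec_ideal q -> p = q.
Proof.
case: p q => [p pP] [q qP] /= epq; case: q / epq qP => qP.
by congr MkSpec; exact: Prop_irrelevance.
Qed.

(** No other member lies inside a minimal prime, so a product of elements of the others can avoid
    it. *)
Lemma minimal_prime_seq (R : comPzRingType) (ps : seq (Spec R)) : ps != [::] ->
  exists2 p, p \in ps &
    forall q, q \in ps -> spec_ideal q `<=` spec_ideal p -> q = p.
Proof.
elim: ps => // x ps IH _; have [->|/IH[p pps pmin]] := eqVneq ps [::].
  by exists x; rewrite ?inE // => q; rewrite inE => /eqP.
have [xp|nxp] := pselect (spec_ideal x `<=` spec_ideal p).
  exists x; first by rewrite inE eqxx.
  move=> q; rewrite inE => /orP[/eqP//|qps] qx.
  have qp := pmin q qps (subset_trans qx xp).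
  by apply/Spec_inj/seteqP; split; rewrite // qp.
exists p; first by rewrite inE pps orbT.
by move=> q; rewrite inE => /orP[/eqP ->|/pmin].
Qed.

(** * Deleting a row or a column *)

Section Rows.
Variable R : comPzRingType.

Lemma mulmx_col'_row' k n m (i : 'I_n.+1) (V : 'M[R]_(k, n.+1)) (T : 'M[R]_(n.+1, m)) :
  V *m T = col' i V *m row' i T + col i V *m row i T.
Proof.
apply/matrixP => a c; rewrite !mxE (bigD1_ord i) //= addrC big_ord1 !mxE.
by congr (_ + _); apply: eq_bigr => l _; rewrite !mxE.
Qed.

(** Left multiplication by [row' i 1%:M] deletes row i, and its transpose reinserts a zero row; this
    is the right inverse needed in [surj_at_mull]. *)
Lemma row'1_tr n (i : 'I_n.+1) :
  row' i (1%:M : 'M[R]_n.+1) *m (row' i 1%:M)^T = 1%:M.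
Proof.
apply/matrixP => a c; rewrite !mxE (bigD1 (lift i c)) //= !mxE eqxx mulr1.
rewrite big1 => [|l nl]; last by rewrite !mxE (eq_sym (lift i c)) (negPf nl) mulr0.
by rewrite addr0 (inj_eq lift_inj).
Qed.

Lemma delta_row'1_tr n (i : 'I_n.+1) :
  (delta_mx 0 i : 'rV[R]_n.+1) *m (row' i 1%:M)^T = 0.
Proof.
apply/rowP => c; rewrite -rowE !mxE.
by rewrite eq_sym (negPf (neq_lift i c)).
Qed.

End Rows.

(* The R-module under study is 'rV_b modulo [Rel], and [L] plays the part of the
   image of (f_1, ..., f_n0) : M -> N^n0, lifted to coordinates. *)
Section Capacity.
Variables (R : comPzRingType) (b n0 : nat) (Rel : set 'rV[R]_b) (L : set 'M[R]_(n0, b)).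
Hypotheses (subRel : is_submodule Rel) (subL : is_submodule L).
Implicit Types p q : Spec R.

Definition relmx k (Z : 'M[R]_(k, b)) : Prop := forall i, Rel (row i Z).

Lemma relmxD k (Z Z' : 'M[R]_(k, b)) : relmx Z -> relmx Z' -> relmx (Z + Z').
Proof.
by case: subRel => _ RD _ RZ RZ' i; rewrite raddfD; exact: (RD _ _ (RZ i) (RZ' i)).
Qed.

Lemma relmx_mul h k (A : 'M[R]_(h, k)) (Z : 'M[R]_(k, b)) : relmx Z -> relmx (A *m Z).
Proof.
move=> RZ i; rewrite row_mul mulmx_sum_row.
exact: (submodule_sum _ subRel).
Qed.

Lemma relmxZ k a (Z : 'M[R]_(k, b)) : relmx Z -> relmx (a *: Z).
Proof. by rewrite -mul_scalar_mx; exact: relmx_mul. Qed.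

(** The rows of V are k combinations of the f_i, and s kills the cokernel of the map that they form.
    For a finitely generated target, surjectivity at p means that some s outside p does so, which
    avoids fractions. *)
Definition surj_by k (s : R) (V : 'M[R]_(k, n0)) : Prop :=
  forall Y : 'M[R]_(k, b), exists l, L l /\ relmx (V *m l - s *: Y).

Definition surj_at p k (V : 'M[R]_(k, n0)) : Prop :=
  exists2 s, ~ spec_ideal p s & surj_by s V.

(** Cramer's rule: if every row of C, read as a k by b matrix, is hit modulo [Rel], then so is their
    combination with coefficients [mxvec Y *m \adj C], which is [\det C *: Y]. *)
Lemma surj_by_det k (V : 'M[R]_(k, n0)) (C : 'M[R]_(k * b)) :
  (forall j, exists l, L l /\ relmx (V *m l - vec_mx (row j C))) ->
  surj_by (\det C) V.
Proof.
move=> /choice[l lP] Y.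
pose a := mxvec Y *m \adj C.
have aC : \sum_j a 0 j *: vec_mx (row j C) = \det C *: Y.
  rewrite -[Y in RHS]mxvecK -linearZ -mul_mx_scalar -mul_adj_mx mulmxA.
  rewrite mulmx_sum_row linear_sum; apply: eq_bigr => j _.
  by rewrite [RHS]linearZ.
exists (\sum_j a 0 j *: l j); split.
  by apply: submodule_sum => // j; case: (lP j).
rewrite -aC mulmx_sumr -sumrB; apply: (big_ind (@relmx k)).
- by case: subRel => R0 _ _ i; rewrite row0.
- exact: relmxD.
- by move=> j _; rewrite -scalemxAr -scalerBr; apply: relmxZ; case: (lP j).
Qed.

(** The denominator may depend on Y: the product of those of the basis matrices, a diagonal
    determinant, serves for all Y. *)
Lemma surj_at_pointwise p k (V : 'M[R]_(k, n0)) :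
  (forall Y : 'M[R]_(k, b), exists s, ~ spec_ideal p s /\
     exists l, L l /\ relmx (V *m l - s *: Y)) ->
  surj_at p V.
Proof.
move=> h; have /choice[s sP] := fun j => h (vec_mx (delta_mx 0 j)).
exists (\det (diag_mx (\row_j s j))).
  by rewrite det_diag; apply: nprime_prod => j; rewrite mxE; case: (sP j).
apply: surj_by_det => j; case: (sP j) => _ [l [Ll lP]]; exists l; split=> //.
by rewrite row_diag_mx [vec_mx _]linearZ mxE.
Qed.

(** Preimages of s times the basis at parameter c are kept while the parameter x varies: they then
    hit the rows of s + (x - c) B, whose determinant is a power of s at x = c. Hence
    [det_affine_avoid] finds a multiple of u. *)
Lemma surj_at_affine p k (U0 U1 : 'M[R]_(k, n0)) (c u : R) :
  ~ spec_ideal p u -> surj_at p (U0 + c *: U1) ->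
  exists d, surj_at p (U0 + (u * d) *: U1).
Proof.
move=> nu [s ns h].
have /choice[l lP] := fun j => h (vec_mx (delta_mx 0 j)).
pose B : 'M[R]_(k * b) := \matrix_j mxvec (U1 *m l j).
have [|d nd] := @det_affine_avoid R p _ (s%:M - c *: B) B c u _ nu.
  by rewrite subrK det_scalar; exact: nprimeX.
exists d, (\det (s%:M - c *: B + (u * d) *: B)) => //.
apply: surj_by_det => j; exists (l j); case: (lP j) => Ll relj; split=> //.
have -> : row j (s%:M - c *: B + (u * d) *: B) =
  s *: delta_mx 0 j + (u * d - c) *: mxvec (U1 *m l j).
  apply/rowP => i; rewrite !mxE eqxx /=.
  by rewrite (eq_sym j) mulr_natr -addrA mulrBl [- _ + _]addrC.
rewrite linearD !linearZ /= mxvecK scalerBl opprD opprB.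
move: relj; rewrite !mulmxDl -!scalemxAl; congr relmx.
rewrite -[LHS]addrA -[RHS]addrA; congr (_ + _).
by rewrite [RHS]addrC -addrA subrK addrC.
Qed.

(** A form of Nakayama's lemma: preimages of s times the basis under V hit, under V', the rows of a
    matrix congruent to s mod p, whose determinant is then outside p. *)
Lemma surj_at_mod p k (V V' : 'M[R]_(k, n0)) :
  (forall i j, spec_ideal p (V i j - V' i j)) -> surj_at p V -> surj_at p V'.
Proof.
move=> VV' [s ns h]; have /choice[l lP] := fun j => h (vec_mx (delta_mx 0 j)).
pose C : 'M[R]_(k * b) := s%:M + \matrix_j mxvec ((V' - V) *m l j).
have CE i j : spec_ideal p (C i j - (s%:M : 'M_(k * b)) i j).
  rewrite mxE addrAC subrr add0r mxE; case/mxvec_indexP: j => i' j'.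
  rewrite mxvecE; apply: prime_mulmx => x y; rewrite !mxE -opprB.
  by apply: primeN; have := VV' x y.
exists (\det C).
  by move=> /(det_mod_prime CE); rewrite det_scalar; exact: nprimeX.
apply: surj_by_det => j; exists (l j); case: (lP j) => Ll relj; split=> //.
have -> : row j C = s *: delta_mx 0 j + mxvec ((V' - V) *m l j).
  by apply/rowP => i; rewrite !mxE eqxx /= (eq_sym j) mulr_natr.
move: relj; congr relmx.
have -> : vec_mx (s *: delta_mx 0 j + mxvec ((V' - V) *m l j)) =
  s *: vec_mx (delta_mx 0 j) + (V' - V) *m l j.
  by rewrite linearD linearZ /= mxvecK.
rewrite mulmxBl opprD opprB.
by rewrite [RHS]addrC -addrA subrK addrC.
Qed.

Lemma surj_at_mull p h k (A : 'M[R]_(h, k)) (B : 'M[R]_(k, h)) (u : R)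
  (V : 'M[R]_(k, n0)) :
  A *m B = u%:M -> ~ spec_ideal p u -> surj_at p V -> surj_at p (A *m V).
Proof.
move=> AB nu [s ns sV]; exists (s * u); first exact: nprimeM.
move=> Y; have [l [Ll lP]] := sV (B *m Y); exists l; split=> //.
have := relmx_mul A lP; congr relmx.
by rewrite mulmxBr -scalemxAr !mulmxA AB mul_scalar_mx scalerA.
Qed.

Lemma surj_atZ p k (u : R) (V : 'M[R]_(k, n0)) :
  ~ spec_ideal p u -> surj_at p V -> surj_at p (u *: V).
Proof.
by move=> nu; rewrite -mul_scalar_mx; apply: (surj_at_mull (B := 1%:M));
  rewrite ?mulmx1.
Qed.

Lemma surj_atZ_inv p k (u : R) (V : 'M[R]_(k, n0)) :
  surj_at p (u *: V) -> surj_at p V.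
Proof.
case: subL => _ _ LZ [s ns sV]; exists s => // Y.
have [l [Ll lP]] := sV Y; exists (u *: l); split; first exact: LZ.
by rewrite -scalemxAr scalemxAl.
Qed.

(** A relation in k instead of a maximal value: at a prime where the module localizes to zero, every
    k qualifies. *)
Definition capacity p n (T : 'M[R]_(n, n0)) (k : nat) : Prop :=
  exists V : 'M[R]_(k, n), surj_at p (V *m T).

Lemma capacity0 p n (T : 'M[R]_(n, n0)) : capacity p T 0.
Proof.
exists 0, 1; first exact: prime1.
by move=> Y; exists 0; case: subL => L0 _ _; split=> // -[].
Qed.

Lemma capacity_le p n (T : 'M[R]_(n, n0)) k k' :
  (k' <= k)%N -> capacity p T k -> capacity p T k'.
Proof.
elim: k => [|k IH]; first by rewrite leqn0 => /eqP ->.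
rewrite leq_eqVlt => /orP[/eqP->//|/IH h] [V sV]; apply: h.
exists (row' ord0 1%:M *m V); rewrite -mulmxA.
apply: surj_at_mull sV; last exact: prime1.
exact: row'1_tr.
Qed.

Lemma capacity_mull p n (T : 'M[R]_(n, n0)) (E E' : 'M[R]_n) k :
  E' *m E = 1%:M -> capacity p T k -> capacity p (E *m T) k.
Proof.
by move=> EE [V sV]; exists (V *m E'); rewrite mulmxA -(mulmxA V) EE mulmx1.
Qed.

Lemma capacity_mod p n (T T' : 'M[R]_(n, n0)) k :
  (forall i j, spec_ideal p (T i j - T' i j)) -> capacity p T k -> capacity p T' k.
Proof.
move=> TT' [V sV]; exists V; apply: surj_at_mod sV => i j.
have TT2 x y : spec_ideal p ((T - T') x y) by rewrite !mxE.
have := prime_mulmxr V TT2 i j.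
by rewrite mulmxBr mxE [in X in _ + X]mxE.
Qed.

Lemma capacity_row' p n (T : 'M[R]_(n.+1, n0)) (i : 'I_n.+1) k :
  capacity p T k.+1 -> capacity p (row' i T) k.
Proof.
move=> [V]; rewrite (mulmx_col'_row' i) => sV.
have [/existsNP[j nj]|/contrapT allp] := pselect (~ forall j, spec_ideal p (V j i)).
  pose c := col i V; pose W : 'M[R]_(k, k.+1) := row' j 1%:M.
  (* Elimination without division: A takes each row of V times [V j i], subtracts the multiple of
     row j that cancels column i, and deletes row j. *)
  pose A := W *m ((V j i)%:M - c *m delta_mx 0 j).
  have Ac : A *m c = 0.
    rewrite -mulmxA mulmxBl -[c *m _ *m c]mulmxA -rowE.
    have -> : row j c = (V j i)%:M by apply/rowP => z; rewrite ord1 !mxE mulr1n.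
    by rewrite mul_scalar_mx mul_mx_scalar subrr mulmx0.
  exists (A *m col' i V); rewrite -mulmxA.
  have <- : A *m (col' i V *m row' i T + c *m row i T) = A *m (col' i V *m row' i T).
    by rewrite mulmxDr (mulmxA A c) Ac mul0mx addr0.
  apply: (surj_at_mull (B := W^T) _ nj sV).
  by rewrite -mulmxA mulmxBl -(mulmxA c) delta_row'1_tr mulmx0 subr0
             mul_scalar_mx -scalemxAr row'1_tr scalemx1.
apply: capacity_le (leqnSn k) _; exists (col' i V); apply: surj_at_mod sV => x y.
rewrite mxE addrAC subrr add0r; apply: prime_mulmx => a a'.
by rewrite mxE.
Qed.

(** The coordinates of y are moved into the multiples of u one at a time; each of them enters
    affinely, so [surj_at_affine] applies. *)
Lemma surj_at_clear_coords p k n (U : 'M[R]_(k, n0)) (W : 'M[R]_(k, n))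
  (t : 'rV[R]_n0) (y : 'cV[R]_n) (u : R) :
  ~ spec_ideal p u -> surj_at p (U + W *m y *m t) ->
  exists a : 'cV[R]_n, surj_at p (U + W *m (u *: a) *m t).
Proof.
move=> nu sy.
suff all j : (j <= n)%N -> exists2 z : 'cV[R]_n, (exists a : 'I_n -> R,
    forall i : 'I_n, (i < j)%N -> z i 0 = u * a i) & surj_at p (U + W *m z *m t).
  have [z [a za] sz] := all n (leqnn n).
  exists (\col_i a i); suff <- : z = u *: \col_i a i by [].
  by apply/colP => i; rewrite za ?ltn_ord // !mxE.
elim: j => [|j IH] le_jn.
  by exists y => //; exists (fun=> 0).
have [z [a za] sz] := IH (ltnW le_jn); pose J := Ordinal le_jn.
pose U0 := U + W *m (z - z J 0 *: delta_mx J 0) *m t.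
have line c : U0 + c *: (W *m delta_mx J 0 *m t) =
    U + W *m (z + (c - z J 0) *: delta_mx J 0) *m t.
  rewrite /U0 -addrA; congr (_ + _).
  rewrite (scalemxAl c (W *m _) t) (scalemxAr c W) -mulmxDl -mulmxDr -addrA.
  congr (W *m (z + _) *m t).
  by rewrite scalerBl addrC.
have [|d sd] := surj_at_affine (U0 := U0) (U1 := W *m delta_mx J 0 *m t) (c := z J 0) nu.
  by rewrite line subrr scale0r addr0.
move: sd; rewrite line => sd; exists (z + (u * d - z J 0) *: delta_mx J 0) => //.
exists (fun i => if i == J then d else a i) => i; rewrite ltnS leq_eqVlt => lt_ij.
rewrite !mxE eqxx andbT; case: eqP => [->|/eqP nij].
  by rewrite mulr1 addrC subrK.
rewrite mulr0 addr0 za //; case/orP: lt_ij => // /eqP e.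
by case/eqP: nij; apply/val_inj.
Qed.

(* A relation mod p between the columns of [V] has, after one elementary
   operation, its last coefficient outside p; then the last column is a
   combination of the others mod p, and by [surj_at_clear_coords] the
   coefficients may be taken in rR. *)
Lemma capacity_elementary p r n (T : 'M[R]_(n.+1, n0)) k :
  ~ spec_ideal p r -> (k <= n)%N -> capacity p T k ->
  exists G E', E' *m (1%:M + r *: G) = 1%:M /\
    capacity p (row' ord_max ((1%:M + r *: G) *m T)) k.
Proof.
move=> nr le_kn [V sV].
have [w [[i nwi] Vw]] := @ker_col_mod_prime R p k n.+1 V le_kn.
(* If the last coefficient lies in p, adding r times the coefficient i moves it out, since r and
   [w i 0] avoid p. *)
have [G1 [E1' [E11 E1w]]] : exists G1 E1', E1' *m (1%:M + r *: G1) = 1%:M /\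
    ~ spec_ideal p (((1%:M + r *: G1) *m w) ord_max 0).
  have [pmax|nmax] := pselect (spec_ideal p (w ord_max 0)); last first.
    by exists 0, 1%:M; rewrite scaler0 addr0 !mul1mx.
  have im : i != ord_max by apply: contra_notN nwi => /eqP ->.
  pose G1 : 'M[R]_n.+1 := delta_mx ord_max i.
  have G11 : G1 *m G1 = 0 by rewrite mul_delta_mx_0.
  exists G1, (1%:M - r *: G1); split.
    rewrite mulmxDr mulmx1 mulmxBl mul1mx -!scalemxAl -!scalemxAr G11.
    by rewrite !scaler0 subr0 subrK.
  rewrite mulmxDl mul1mx -scalemxAl mxE => pw.
  have := primeD pw (primeN pmax); rewrite addrAC subrr add0r mxE.
  apply: nprimeM => //; rewrite mxE (bigD1 i) //= big1 => [|l nl].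
    by rewrite mxE !eqxx mul1r addr0.
  by rewrite mxE eqxx (negPf nl) mul0r.
pose E1 := 1%:M + r *: G1; pose T1 := E1 *m T; pose V1 := V *m E1'.
pose w1 := E1 *m w; pose s := w1 ord_max 0.
have sV1 : surj_at p (V1 *m T1) by rewrite /V1 /T1 -mulmxA (mulmxA E1') E11 mul1mx.
have Vw1 j : spec_ideal p ((V1 *m w1) j 0).
  by rewrite /V1 /w1 -mulmxA (mulmxA E1') E11 mul1mx.
pose V' := col' ord_max V1; pose T' := row' ord_max T1.
pose t := row ord_max T1; pose y := - row' ord_max w1.
(* By the relation w1, whose last coefficient is s, the last column of V1 times s is [V' *m y] mod
   p. *)
have s1 : surj_at p (s *: (V' *m T') + V' *m y *m t).
  have := surj_atZ (u := s) E1w sV1; apply: surj_at_mod => a c.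
  rewrite (mulmx_col'_row' ord_max V1 T1) scalerDr.
  set Z := s *: (col' _ _ *m _); set Z' := s *: (V' *m T').
  have -> : (Z + s *: (col ord_max V1 *m t)) a c - (Z' + V' *m y *m t) a c =
    ((s *: col ord_max V1 - V' *m y) *m t) a c.
    by rewrite mulmxBl -scalemxAl !mxE opprD addrACA subrr add0r.
  apply: prime_mulmx => {}a {}c; rewrite ord1.
  have := Vw1 a; congr (spec_ideal _ (fun_of_matrix _ _ _)).
  have ws : row ord_max w1 = s%:M.
    by apply/rowP => z; rewrite ord1 [LHS]mxE [RHS]mxE eqxx mulr1n.
  by rewrite (mulmx_col'_row' ord_max V1 w1) ws mul_mx_scalar /y mulmxN opprK addrC.
(* With u = s r the factor s can be cancelled from the whole matrix at the end, leaving the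
   coefficients [r *: a]. *)
have [|a sa] := surj_at_clear_coords (u := s * r) _ s1; first exact: nprimeM.
(* [1%:M + r *: G2] adds the multiples [r *: a] of the last row to the other rows; as G2 squares to
   zero, [1%:M - r *: G2] inverts it. *)
pose G2 : 'M[R]_n.+1 := (row' ord_max 1%:M)^T *m a *m delta_mx 0 ord_max.
have G22 : G2 *m G2 = 0.
  by rewrite /G2 -!mulmxA (mulmxA (delta_mx _ _)) delta_row'1_tr mul0mx !mulmx0.
exists (G1 + G2 + r *: (G2 *m G1)), (E1' *m (1%:M - r *: G2)).
have -> : 1%:M + r *: (G1 + G2 + r *: (G2 *m G1)) = (1%:M + r *: G2) *m E1.
  rewrite /E1 mulmxDl mul1mx mulmxDr mulmx1 -scalemxAl -scalemxAr !scalerDr.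
  by rewrite -!addrA; congr (_ + _); congr (_ + _); rewrite -scalemxAl.
split.
  have inv2 : (1%:M - r *: G2) *m (1%:M + r *: G2) = 1%:M.
    rewrite mulmxDr mulmx1 mulmxBl mul1mx -scalemxAl -scalemxAr G22.
    by rewrite !scaler0 subr0 subrK.
  by rewrite -mulmxA (mulmxA (1%:M - _)) inv2 mul1mx.
exists V'; rewrite -mulmxA -/T1.
have -> : row' ord_max ((1%:M + r *: G2) *m T1) = T' + r *: (a *m t).
  have GT : G2 *m T1 = (row' ord_max 1%:M)^T *m (a *m t).
    by rewrite /G2 -!mulmxA -rowE.
  have row'M (Z : 'M[R]_(n, n0)) : row' ord_max ((row' ord_max 1%:M)^T *m Z) = Z.
    have row'E (Z' : 'M[R]_(n.+1, n0)) : row' ord_max Z' = row' ord_max 1%:M *m Z'.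
      apply/matrixP => x z; rewrite !mxE (bigD1 (lift ord_max x)) //= !mxE eqxx mul1r.
      by rewrite big1 ?addr0 // => l nl; rewrite !mxE eq_sym (negPf nl) mul0r.
    by rewrite row'E mulmxA row'1_tr mul1mx.
  rewrite mulmxDl mul1mx -scalemxAl GT /T' -[in RHS](row'M (a *m t)).
  by apply/matrixP => x z; rewrite !mxE.
rewrite mulmxDr -scalemxAr; apply: (@surj_atZ_inv p _ s).
by move: sa; rewrite scalerDr -scalemxAr -scalemxAl scalerA mulmxA.
Qed.

(** A minimal prime p0 of the list is treated last. Its operation is [1%:M + r *: G] with r outside
    p0 but in all the other primes, so it is the identity mod those and disturbs nothing achieved
    there. *)
Lemma capacity_elementary_seq n (T : 'M[R]_(n.+1, n0)) (kk : Spec R -> nat)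
  (ps : seq (Spec R)) :
  (forall p, p \in ps -> (kk p <= n)%N /\ capacity p T (kk p)) ->
  exists E E' : 'M[R]_n.+1, E' *m E = 1%:M /\
    forall p, p \in ps -> capacity p (row' ord_max (E *m T)) (kk p).
Proof.
have [m] := ubnP (size ps); elim: m ps => // m IH ps; rewrite ltnS => sz hps.
have [->|ps0] := eqVneq ps [::].
  by exists 1%:M, 1%:M; rewrite mulmx1.
have [p0 p0ps pmin] := minimal_prime_seq ps0.
have [|p|E [E' [EE hE]]] := IH [seq x <- ps | x != p0].
- apply: leq_trans sz; rewrite size_filter -(count_predC (pred1 p0)) addnC.
  by rewrite -[X in (X < _)%N]addn0 ltn_add2l -has_count; apply/hasP; exists p0 => /=.
- by rewrite mem_filter => /andP[_ /hps].
have [r nr rps] : exists2 r, ~ spec_ideal p0 r &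
    forall q, q \in ps -> q != p0 -> spec_ideal q r.
  elim: (ps) pmin => [|x qs IHq] pmin; first by exists 1; [exact: prime1|].
  have [q qqs|r nr rq] := IHq; first by apply: pmin; rewrite inE qqs orbT.
  have [->|xp0] := eqVneq x p0.
    by exists r => // q; rewrite inE => /orP[/eqP ->|/rq//]; rewrite eqxx.
  have [z xz nz] : exists2 z, spec_ideal x z & ~ spec_ideal p0 z.
    apply: contrapT => nz; case/eqP: xp0; apply: pmin; rewrite ?inE ?eqxx //.
    by move=> z xz; apply: contrapT => npz; apply: nz; exists z.
  exists (z * r); first exact: nprimeM.
  move=> q; rewrite inE => /orP[/eqP -> _|qqs /(rq q qqs)]; first exact: primeMr.
  exact: primeMl.
have [le0 cap0] := hps _ p0ps.
have [G [F' [FF hF]]] := capacity_elementary nr le0 (capacity_mull EE cap0).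
exists ((1%:M + r *: G) *m E), (E' *m F'); split.
  by rewrite -mulmxA (mulmxA F') FF mul1mx.
move=> q qps; have [->|qp0] := eqVneq q p0; first by rewrite -mulmxA.
have := hE q; rewrite mem_filter /= qp0 => /(_ qps).
apply: capacity_mod => i j.
rewrite -mulmxA mulmxDl mul1mx -scalemxAl !mxE opprD addNKr.
by apply/primeN/primeMr/rps.
Qed.

(** * Shortening a family under the dimension bound *)

Section DimensionDescent.
Hypothesis noethR : noetherian R.
Variables (X : set (Spec R)) (d : Spec R -> nat) (t : nat).
Hypothesis capX : forall (F : set (Spec R)) (p : Spec R), F `<=` X ->
  spec_ideal p = \bigcap_(q in F) spec_ideal q -> X p.
Hypothesis d_lt : forall p q, X p -> X q ->
  spec_ideal q `<=` spec_ideal p -> q <> p -> (d p < d q)%N.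

(* Where the capacity of [T] is exactly k = min(n, t + d p), p is either a generic
   point of {p in X | capacity of T <= k}, and k is preserved, or strictly contains
   one, q say; then d q > d p, and the bound assumed at q exceeds k. *)
Lemma capacity_step n (T : 'M[R]_(n.+1, n0)) :
  (forall p, X p -> capacity p T (minn n.+1 (t + d p))) ->
  exists T' : 'M[R]_(n, n0), forall p, X p -> capacity p T' (minn n (t + d p)).
Proof.
move=> capT.
(* Capacity at p exceeds k exactly when some element of [E k] avoids p, so the loci of low capacity
   are zero loci in X. *)
pose E k : set R := [set s | exists V : 'M[R]_(k.+1, n.+1), surj_by s (V *m T)].
have /choice[ps psP] := fun k => generic_points noethR capX (E k).
have ncap k p : ~ capacity p T k.+1 <-> E k `<=` spec_ideal p.
  split=> [nc s [V sV]|Ep [V [s ns sV]]].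
    by apply: contrapT => ns; apply: nc; exists V, s.
  by apply/ns/Ep; exists V.
(* [kk p] is the largest value at p not exceeding n, the range in which [capacity_elementary_seq]
   preserves it. *)
have /choice[kk kkP] p : exists m, [/\ (m <= n)%N, capacity p T m &
    forall k, (k <= n)%N -> capacity p T k -> (k <= m)%N].
  pose Q k := (k <= n)%N && `[< capacity p T k >].
  have exQ : exists k, Q k by exists 0%N; apply/asboolP/capacity0.
  have leQ k : Q k -> (k <= n)%N by case/andP.
  case: (ex_maxnP exQ leQ) => m /andP[le_mn /asboolP cm] mmax.
  by exists m; split=> // k le_kn ck; apply: mmax; rewrite /Q le_kn; exact/asboolP.
have [p _|F [F' [FF hF]]] := @capacity_elementary_seq n T kk
    (flatten [seq ps k | k <- iota 0 n.+1]).
  by case: (kkP p).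
exists (row' ord_max (F *m T)) => p Xp; set k := minn n _.
have le_kn : (k <= n)%N by rewrite geq_minl.
have [ck1|nck1] := pselect (capacity p T k.+1).
  by apply: capacity_row'; exact: capacity_mull FF ck1.
have ck : capacity p T k.
  by apply: capacity_le (capT p Xp); rewrite leq_min !geq_min leqnSn leqnn orbT.
have [psX /(_ p Xp)] := psP k; case; first exact/ncap.
move=> q qps qp; have [Xq /ncap nq] := psX q qps.
have [eqp|nqp] := pselect (q = p).
  apply: (@capacity_le _ _ _ (kk p)).
    by case: (kkP p) => _ _; apply.
  apply: hF; rewrite -eqp; apply/flatten_mapP; exists k => //.
  by rewrite mem_iota ltnS le_kn.
case: nq; apply: capacity_le (capT q Xq).
by rewrite /k -minnSS leq_min geq_minl geq_min -addnS leq_add2l d_lt ?orbT.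
Qed.

Lemma capacity_descent m (T : 'M[R]_(t + m, n0)) :
  (forall p, X p -> capacity p T (minn (t + m) (t + d p))) ->
  exists T' : 'M[R]_(t, n0), forall p, X p -> capacity p T' t.
Proof.
elim: m T => [|m IH].
  rewrite addn0 => T capT; exists T => p /capT.
  by rewrite (minn_idPl _) // leq_addr.
by rewrite addnS => T /capacity_step[T']; exact: IH.
Qed.

End DimensionDescent.

(** If [\det V] is outside p, then V is invertible at p and T inherits surjectivity. Otherwise some
    row w, nonzero mod p, has [w *m V] zero mod p; then the zero map is surjective at p, so the
    module vanishes there, which is excluded. *)
Lemma surj_at_square p n (T : 'M[R]_(n, n0)) :
  ~ (exists2 s, ~ spec_ideal p s & forall y, Rel (s *: y)) ->
  capacity p T n -> surj_at p T.
Proof.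
move=> nRel [V sV]; have [pdet|ndet] := pselect (spec_ideal p (\det V)); last first.
  apply: (@surj_atZ_inv _ _ (\det V)).
  rewrite -mul_scalar_mx -mul_adj_mx -mulmxA.
  by apply: surj_at_mull ndet sV; exact: mul_adj_mx.
have [w [[i nwi] wV]] := ker_row_mod_prime pdet.
have ws : w *m (delta_mx i 0 : 'cV[R]_n) = (w 0 i)%:M.
  by rewrite -colE; apply/rowP => j; rewrite ord1 !mxE eqxx mulr1n.
case: nRel.
have [] : surj_at p (0 : 'M[R]_(1, n0)).
  apply: surj_at_mod (surj_at_mull ws nwi sV) => a c.
  by rewrite [X in _ - X]mxE subr0 mulmxA; apply: prime_mulmx => {}a j; rewrite ord1.
move=> s ns s0; exists (- s).
  by move=> /primeN; rewrite opprK.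
move=> y; have [l [_ /(_ 0)]] := s0 y.
by rewrite mul0mx sub0r scaleNr; congr Rel; apply/rowP => j; rewrite !mxE.
Qed.

End Capacity.

(** * Maps between localizations *)

Lemma fg_module_fin (A : pzRingType) (V : lmodType A) (I : finType) (e : I -> V) :
  (forall v : V, exists c : I -> A, v = \sum_i c i *: e i) -> fg_module V.
Proof.
move=> eV; exists #|I|, (fun k => e (enum_val k)) => v.
have [c ->] := eV v; exists (fun k => c (enum_val k)).
by rewrite (reindex (@enum_val I I)) //; exact: (onW_bij _ (enum_val_bij I)).
Qed.

Section Localizing.
Variables (R : comPzRingType) (S : pzRingType) (phi : algebra R S).
Local Notation Res M := (restrict_scalars phi M).
Local Notation fr := Defs.frac.

Lemma res_scaleE (M : lmodType S^c) (r : R) (m : Res M) :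
  r *: m = ract (m : M) (phi r).
Proof. by []. Qed.

Lemma ract_resZ (M : lmodType S^c) (r : R) (m : Res M) (a : S) :
  ract (r *: m : M) a = (r *: (ract m a : Res M) : Res M).
Proof. by rewrite !res_scaleE !ractA alg_central. Qed.

Lemma fg_restrict_scalars (M : lmodType S^c) :
  fg_module (alg_module phi) -> fg_module M -> fg_module (Res M).
Proof.
move=> [a [s sS]] [b [e eM]].
apply: (@fg_module_fin _ _ ('I_b * 'I_a)%type
  (fun ij => ract (e ij.1) (s ij.2) : Res M)) => v.
have [c vc] := eM v.
have /choice[r rc] i : exists r : 'I_a -> R,
    (c i : alg_module phi) = \sum_(j < a) r j *: s j by exact: sS.
exists (fun ij => r ij.1 ij.2).
rewrite -(pair_bigA _ (fun i j => r i j *: (ract (e i) (s j) : Res M))) /=.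
rewrite vc; apply: eq_bigr => i _.
rewrite rc scaler_suml; apply: eq_bigr => j _.
by rewrite res_scaleE ractA -alg_central.
Qed.

Lemma linear_resZ (M N : lmodType S^c) (f : {linear M -> N}) (r : R) (m : Res M) :
  f (r *: m : Res M) = (r *: (f m : Res N) : Res N).
Proof. exact: linearZ. Qed.

Lemma not_SuppP (N : lmodType S^c) (p : Spec R) : fg_module (Res N) ->
  ~ Supp phi N p <-> exists2 u, ~ spec_ideal p u & forall v : Res N, u *: v = 0.
Proof.
move=> [b [e eN]]; split.
  move=> nS; have /choice[u uP] i : exists u : denom p, (u : R) *: e i = 0.
    have [/frac_eqP[u]|ne] := pselect (fr (e i) (denom1 p) = fr 0 (denom1 p)).
      by rewrite scaler0 scaler0 scale1r => ue; exists u.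
    case: nS; exists (fr (e i) (denom1 p) : loc_module p phi N).
    by apply/eqP => h; apply: ne; rewrite h; symmetry; exact: frac0.
  exists (\prod_i (u i : R)); first by apply: nprime_prod => i; exact: denomP.
  move=> v; have [c ->] := eN v; rewrite scaler_sumr big1 // => i _.
  by rewrite (bigD1 i) //= scalerA -mulrA mulrC -scalerA uP scaler0.
move=> [u nu uN] [x]; elim/fracW: x => v s /eqP; apply.
rewrite -(frac0 _ s); apply/frac_eqP; exists (MkDenom nu).
by rewrite /= !uN.
Qed.

Section HomLift.
Variables (M N : lmodType S^c) (p : Spec R).
Local Notation Mp := (loc_module p phi M).
Local Notation Np := (loc_module p phi N).
Local Notation Sp := (loc_ring p phi).

Local Notation "m /p s" := (fr (m : Res _) s : loc_module p phi _) (at level 40).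
Local Notation "a /1" := (fr (a : alg_module phi) (denom1 p) : Sp^c) (at level 8).

Lemma loc_scale_fr (V : lmodType S^c) (a : S) (v : V) (s : denom p) :
  a/1 *: (fr (v : Res V) s : loc_module p phi V) = fr (ract v a : Res V) s.
Proof.
rewrite [LHS]loc_scaleE; apply/frac_eqP; exists (denom1 p).
by rewrite /= mulr1.
Qed.

Lemma loc_scale_phi (V : lmodType S^c) (r : R) (v : Res V) (s : denom p) :
  (phi r)/1 *: (fr v s : loc_module p phi V) = fr (r *: v) s.
Proof. by rewrite loc_scale_fr. Qed.

(** The kernel of V -> V_p is finitely generated, so the product of denominators killing its
    generators kills all of it. *)
Lemma torsion_killed (V : lmodType R) : noetherian R -> fg_module V ->
  exists2 u, ~ spec_ideal p u & forall v : V,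
    (exists2 u', ~ spec_ideal p u' & u' *: v = 0) -> u *: v = 0.
Proof.
move=> noethR fgV.
pose T := [set v : V | exists2 u', ~ spec_ideal p u' & u' *: v = 0].
have [|n [e [Te eT]]] := fg_submodule_noetherian noethR (L := T) fgV.
  split.
  - by exists 1; [exact: prime1|rewrite scaler0].
  - move=> x y [u nu ux] [w nw wy]; exists (u * w); first exact: nprimeM.
    by rewrite scalerDr mulrC -scalerA ux scaler0 mulrC -scalerA wy scaler0 addr0.
  - by move=> a x [u nu ux]; exists u => //; rewrite scalerA mulrC -scalerA ux scaler0.
have /choice[u uP] i : exists u, ~ spec_ideal p u /\ u *: e i = 0.
  by have [u nu ue] := Te i; exists u.
exists (\prod_i u i); first by apply: nprime_prod => i; case: (uP i).
move=> v /eT[c ->]; rewrite scaler_sumr big1 // => i _.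
rewrite (bigD1 i) //= scalerA -mulrA mulrC -scalerA.
by case: (uP i) => _ ->; rewrite scaler0.
Qed.

(* A map M_p -> N_p becomes, after multiplication by a denominator [sigma], the
   localization of a map M -> N: [s] clears the denominators of the images of
   generators of M, and [u] kills the kernel of N -> N_p, so that division by it
   does not matter. *)
Lemma hom_of_loc (h : Mp -> Np) : noetherian R -> fg_module M -> fg_module (Res N) ->
  (forall a x y, h (a *: x + y) = a *: h x + h y) ->
  exists2 sigma, ~ spec_ideal p sigma & exists f : {linear M -> N},
    forall m : M, fr (f m : Res N) (denom1 p) =
      (phi sigma)/1 *: h (fr (m : Res M) (denom1 p)).
Proof.
move=> noethR [b [e eM]] fgN hlin.
have h0 : h 0 = 0.
  by have := hlin 1 0 0; rewrite !scale1r addr0 -{1}[h 0]addr0 => /addrI.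
have hD x y : h (x + y) = h x + h y by have := hlin 1 x y; rewrite !scale1r.
have hZ a x : h (a *: x) = a *: h x by have := hlin a x 0; rewrite h0 !addr0.
pose y i := (repr (h (fr (e i : Res M) (denom1 p)))).1.
pose s i := (repr (h (fr (e i : Res M) (denom1 p)))).2.
have hy i : h (fr (e i : Res M) (denom1 p)) = fr (y i) (s i) by rewrite /y /s frac_repr.
pose s0 := \prod_i (s i : R).
have ns0 : ~ spec_ideal p s0 by apply: nprime_prod => i; exact: denomP.
(* The image of N in N_p is stable under S, so it contains s0 times h of every m once it does so for
   the generators. *)
pose img := [set x : Np | exists n : Res N, fr n (denom1 p) = x].
have img0 : img 0 by exists 0; exact: frac0.
have imgD x z : img x -> img z -> img (x + z).
  move=> [n <-] [n' <-]; exists (n + n'); rewrite [RHS]fracD.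
  by apply/frac_eqP; exists (denom1 p); rewrite /= !scale1r mul1r scale1r.
have imgZ (a : S) x : img x -> img (a/1 *: x).
  by move=> [n <-]; exists (ract (n : N) a); rewrite [RHS]loc_scale_fr.
have hm (m : M) : img ((phi s0)/1 *: h (fr (m : Res M) (denom1 p))).
  have [c ->] := eM m.
  have -> : (fr (\sum_(i < b) c i *: e i : Res M) (denom1 p) : Mp) =
    \sum_(i < b) (c i : S)/1 *: (fr (e i : Res M) (denom1 p) : Mp).
    elim/big_rec2: _ => [|i z m' _ <-]; first exact: frac0.
    rewrite loc_scale_fr [RHS]fracD; apply/frac_eqP; exists (denom1 p).
    by rewrite /= !scale1r mul1r scale1r.
  rewrite (big_morph h hD h0) scaler_sumr.
  apply: (big_ind img) => // i _; rewrite hZ scalerA.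
  have -> : ((phi s0)/1 * (c i : S)/1 : Sp^c) = (c i : S)/1 * (phi s0)/1.
    rewrite [LHS]loc_mulE [RHS]loc_mulE; congr fr; exact: (esym (alg_central _ _ _)).
  rewrite -scalerA; apply: imgZ; rewrite hy loc_scale_phi.
  exists ((\prod_(j | j != i) (s j : R)) *: (y i : Res N)).
  apply/frac_eqP; exists (denom1 p); rewrite /= !scale1r scalerA; congr (_ *: _).
  by rewrite /s0 [RHS](bigD1 i).
have [u nu uT] := torsion_killed noethR fgN.
have /choice[g gP] := hm.
pose f (m : M) : N := u *: g m.
(* [g] is an arbitrary choice of preimages in N; two choices differ by an element that dies in N_p,
   so multiplication by u makes f independent of the choice, hence linear. *)
have uniq_f (m : M) (n : Res N) :
  fr n (denom1 p) = (phi s0)/1 *: h (fr (m : Res M) (denom1 p)) -> f m = u *: n.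
  rewrite -gP => /frac_eqP[w]; rewrite /= !scale1r => /eqP.
  rewrite -subr_eq0 -scalerBr => /eqP wn.
  have := uT (n - g m); rewrite scalerBr => h1; symmetry; apply/eqP.
  by rewrite -subr_eq0; apply/eqP/h1; exists (w : R) => //; exact: denomP.
have f_lin : linear f.
  move=> a m m'.
  rewrite (uniq_f _ (ract (g m : N) a + g m' : Res N)).
    by rewrite scalerDr /f; congr (_ + _); symmetry; exact: ract_resZ.
  have -> : (fr (a *: m + m' : Res M) (denom1 p) : Mp) =
    (a : S)/1 *: (fr (m : Res M) (denom1 p) : Mp) + fr (m' : Res M) (denom1 p).
    rewrite loc_scale_fr [RHS]fracD; apply/frac_eqP; exists (denom1 p).
    by rewrite /= !scale1r mul1r scale1r.
  rewrite hlin scalerDr -gP scalerA.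
  have -> : ((phi s0)/1 * (a : S)/1 : Sp^c) = (a : S)/1 * (phi s0)/1.
    rewrite [LHS]loc_mulE [RHS]loc_mulE; congr fr; exact: (esym (alg_central _ _ _)).
  rewrite -scalerA -gP loc_scale_fr [RHS]fracD; apply/frac_eqP; exists (denom1 p).
  by rewrite /= !scale1r mul1r scale1r.
pose fl := GRing.isLinear.Build _ _ _ _ f f_lin.
pose F : {linear M -> N} := HB.pack f fl.
exists (u * s0); first exact: nprimeM.
exists F => m; rewrite /= /f.
have -> : ((phi (u * s0))/1 : Sp^c) = (phi u)/1 * (phi s0)/1.
  rewrite [RHS]loc_mulE; apply/frac_eqP; exists (denom1 p).
  by rewrite /= mul1r mulrC rmorphM.
by rewrite -scalerA -gP loc_scale_phi.
Qed.

Lemma surj_of_loc k (h : {linear Mp -> {ffun 'I_k -> Np}}) :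
  noetherian R -> fg_module M -> fg_module (Res N) ->
  (forall y, exists x, h x = y) ->
  exists f : 'I_k -> {linear M -> N}, forall y : 'I_k -> Res N,
    exists2 s, ~ spec_ideal p s & exists m : M, forall j, f j m = s *: y j :> Res N.
Proof.
move=> noethR fgM fgN hsurj.
have /choice[sigma /all_and2[nsigma /choice[f fE]]] j : exists sigma : R,
    ~ spec_ideal p sigma /\ exists f : {linear M -> N},
    forall m : M, fr (f m : Res N) (denom1 p) =
      (phi sigma)/1 *: h (fr (m : Res M) (denom1 p)) j.
  have [|sigma ns [f fE]] := @hom_of_loc (fun x => h x j) noethR fgM fgN.
    by move=> a x z; rewrite linearP !ffunE.
  by exists sigma; split=> //; exists f.
exists f => y.
(* The denominators [sigma j] in the target cancel the factors introduced when the components of h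
   were lifted. *)
have [x hx] := hsurj [ffun j => fr (y j) (MkDenom (nsigma j))].
elim/fracW: x hx => m s hx.
have hm j : fr (f j m : Res N) (denom1 p) = fr ((s : R) *: y j) (denom1 p).
  rewrite fE.
  have -> : (fr m (denom1 p) : Mp) = (phi (s : R))/1 *: (fr m s : Mp).
    rewrite loc_scale_phi; apply/frac_eqP; exists (denom1 p).
    by rewrite /= !scale1r.
  rewrite linearZ hx !ffunE !loc_scale_phi; apply/frac_eqP; exists (denom1 p).
  by rewrite /= !scale1r.
have /choice[v vP] j : exists v : denom p,
    (v : R) *: (f j m : Res N) = (v : R) *: ((s : R) *: y j).
  by have /frac_eqP[v] := hm j; rewrite /= !scale1r => e; exists v.
pose w := \prod_j (v j : R).
exists (w * (s : R)); first by apply: nprimeM; [apply: nprime_prod => j|]; exact: denomP.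
exists (w *: (m : Res M)) => j; rewrite linear_resZ -scalerA /w (bigD1 j) //=.
by rewrite mulrC -!scalerA vP.
Qed.

End HomLift.

(** A map is recorded by the coordinates of its values on generators of M. The matrices that arise
    form a submodule of a finite free R-module, hence a finitely generated one. *)
Lemma fg_hom (M N : lmodType S^c) : noetherian R ->
  fg_module (Res M) -> fg_module (Res N) ->
  exists n (F : 'I_n -> {linear M -> N}), forall f : {linear M -> N},
    exists c : 'I_n -> R, forall m : M, f m = \sum_i c i *: (F i m : Res N).
Proof.
move=> noethR [a [e eM]] [b [g gN]].
pose coord (f : {linear M -> N}) (Y : 'M[R]_(a, b)) :=
  forall i, (f (e i) : Res N) = \sum_j Y i j *: g j.
pose H := [set Y | exists f, coord f Y].
have [|n [Y [HY Yspan]]] :=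
    fg_submodule_noetherian noethR (L := H) (fg_module_matrix R a b).
  split.
  - exists (\0 : {linear M -> N}) => i.
    by rewrite big1 //= => j _; rewrite mxE scale0r.
  - move=> Y Z [f fY] [f' fZ]; exists (f \+ f' : {linear M -> N}) => i /=.
    rewrite fY fZ -big_split; apply: eq_bigr => j _ /=.
    by rewrite mxE scalerDl.
  - move=> r Y [f fY].
    have rlin : linear (fun m : M => (r *: (f m : Res N) : N)).
      move=> c x y; rewrite linearP /= scalerDr; congr (_ + _).
      by symmetry; exact: ract_resZ.
    pose rf : {linear M -> N} := HB.pack (fun m : M => (r *: (f m : Res N) : N))
      (GRing.isLinear.Build _ _ _ _ _ rlin).
    exists rf => i /=; rewrite fY scaler_sumr; apply: eq_bigr => j _.
    by rewrite mxE scalerA.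
have /choice[F FY] := HY.
exists n, F => f.
have /choice[Z fZ] i := gN (f (e i)).
have [|c ZY] := Yspan (\matrix_(i, j) Z i j).
  by exists f => i; rewrite fZ; apply: eq_bigr => j _; rewrite mxE.
exists c => m; have [r ->] := eM m.
have fsum (f' : {linear M -> N}) :
    f' (\sum_i r i *: e i : Res M) = \sum_i r i *: (f' (e i) : Res N) :> Res N.
  elim/big_rec2: _ => [|i z x _ <-]; first exact: linear0.
  by rewrite [LHS]raddfD -linear_resZ.
rewrite fsum; under [RHS]eq_bigr do rewrite fsum scaler_sumr.
rewrite exchange_big; apply: eq_bigr => i _ /=.
under eq_bigr do rewrite scalerA mulrC -scalerA.
rewrite -scaler_sumr fZ; congr (_ *: _).
under [RHS]eq_bigr do rewrite FY scaler_sumr.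
rewrite exchange_big; apply: eq_bigr => j _ /=.
have /matrixP/(_ i j) := ZY; rewrite mxE summxE => ->.
by rewrite scaler_suml; apply: eq_bigr => l _; rewrite mxE scalerA.
Qed.

End Localizing.

(** * From local surjections to a global one *)

Section Gluing.
Variables (R : comPzRingType) (S : pzRingType) (phi : algebra R S) (M N : lmodType S^c).
Hypotheses (noethR : noetherian R) (fgS : fg_module (alg_module phi))
  (fgM : fg_module M) (fgN : fg_module N).
Local Notation Res M := (restrict_scalars phi M).
Local Notation X := (jSpec R `&` Supp phi N).

(** This is the closure property asked for in [generic_points]. An intersection of intersections of
    maximal ideals is again one, and an element killing N lies in every prime of the support, hence
    in p. *)
Lemma jSpec_Supp_bigcap (F : set (Spec R)) (p : Spec R) : F `<=` X ->
  spec_ideal p = \bigcap_(q in F) spec_ideal q -> X p.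
Proof.
move=> FX pF; split.
  pose G := [set m : set R | is_maximal_ideal m /\ spec_ideal p `<=` m].
  exists G; split; first by move=> m [].
  apply/seteqP; split=> [x px m [_ pm]|x Gx]; first exact: pm.
  rewrite pF => q Fq; have [[K [Kmax qK]] _] := FX q Fq.
  rewrite qK => m Km; apply: Gx; split; first exact: Kmax.
  rewrite pF => y /(_ q Fq); rewrite qK; exact.
have fgNR := fg_restrict_scalars fgS fgN.
apply: contrapT => /(not_SuppP p fgNR)[u nu uN].
apply: nu; rewrite pF => q Fq; apply: contrapT => nqu.
by have [_] := FX q Fq; apply/(not_SuppP q fgNR); exists u.
Qed.

Lemma maximal_jSpec (p : Spec R) : is_maximal_ideal (spec_ideal p) -> jSpec R p.
Proof.
by move=> pmax; exists [set spec_ideal p]; split=> [_ -> //|]; rewrite bigcap_set1.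
Qed.

(** For fixed y, the s with s y in the image form an ideal. No maximal ideal contains it: one in the
    support belongs to X, and off the support some u outside it kills N. *)
Lemma surjective_of_loc k (f : {linear M -> {ffun 'I_k -> N}}) :
  (forall p, X p -> forall y : 'I_k -> Res N, exists2 s, ~ spec_ideal p s &
     exists m : M, forall j, f m j = s *: y j :> Res N) ->
  forall y, exists x, f x = y.
Proof.
move=> floc y.
pose I := [set s : R | exists m : M, forall j, f m j = s *: (y j : Res N) :> Res N].
suff [m my] : I 1 by exists m; apply/ffunP => j; rewrite my scale1r.
have idI : is_ideal I.
  split.
  - by exists 0 => j; rewrite linear0 ffunE scale0r.
  - by move=> s s' [m ms] [m' ms']; exists (m + m') => j;
       rewrite linearD ffunE ms ms' scalerDl.
  - move=> a s [m ms]; exists (a *: (m : Res M)) => j.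
    by rewrite -scalerA -ms [f _]linearZ ffunE.
apply: contrapT => nI1.
have [m mmax Im] := exists_maximal_ideal noethR idI nI1.
pose p := MkSpec (maximal_ideal_prime mmax).
have [Np|/(not_SuppP p (fg_restrict_scalars fgS fgN))[u nu uN]] :=
  pselect (Supp phi N p).
  have [|s ns Is] := floc p _ (fun j => y j).
    by split=> //; exact: maximal_jSpec.
  by apply: ns; exact: Im.
apply: nu; apply: Im; exists 0 => j.
by rewrite linear0 ffunE uN.
Qed.

(** N is presented as ['rV_b] modulo [Rel], and the descent starts from the identity matrix, the
    whole family of generators of Hom(M, N). The rows of the final T are the coefficients of the
    components of the map. *)
Lemma surjective_of_local_capacity (t : nat) (d : Spec R -> nat) :
  (forall p q, X p -> X q -> spec_ideal q `<=` spec_ideal p -> q <> p ->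
     (d p < d q)%N) ->
  (forall p, X p -> exists2 k, (t + d p <= k)%N &
     exists h : {linear loc_module p phi M -> {ffun 'I_k -> loc_module p phi N}},
       forall y, exists x, h x = y) ->
  exists f : {linear M -> {ffun 'I_t -> N}}, forall y, exists x, f x = y.
Proof.
move=> d_lt locsurj.
have fgMR := fg_restrict_scalars fgS fgM; have fgNR := fg_restrict_scalars fgS fgN.
have [n [F0 F0span]] := fg_hom noethR fgMR fgNR.
(* Padding the generators of Hom(M, N) with zeros makes at least t of them. *)
pose F (i : 'I_(t + n)) : {linear M -> N} :=
  match fintype.split i with inl _ => \0 | inr j => F0 j end.
have Fspan (f : {linear M -> N}) : exists c : 'I_(t + n) -> R,
    forall m : M, f m = \sum_i c i *: (F i m : Res N) :> Res N.
  have [c fc] := F0span f.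
  exists (fun i => match fintype.split i with inl _ => 0 | inr j => c j end) => m.
  rewrite fc big_split_ord /= [X in _ = X + _]big1 ?add0r => [|i _].
    by apply: eq_bigr => i _; rewrite /F (unsplitK (inr i)).
  by rewrite (unsplitK (inl i)) scale0r.
have [b [e eN]] := fgNR.
pose coord (y : 'rV[R]_b) : Res N := \sum_j y 0 j *: e j.
have coordD y z : coord (y + z) = coord y + coord z.
  by rewrite -big_split; apply: eq_bigr => j _; rewrite mxE scalerDl.
have coordZ a y : coord (a *: y) = a *: coord y.
  by rewrite scaler_sumr; apply: eq_bigr => j _; rewrite mxE scalerA.
have coord0 : coord 0 = 0 by rewrite /coord big1 // => j _; rewrite mxE scale0r.
have coord_mul k (c : 'rV[R]_k) (Y : 'M[R]_(k, b)) :
    coord (c *m Y) = \sum_i c 0 i *: coord (row i Y).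
  rewrite mulmx_sum_row (big_morph coord coordD coord0).
  by apply: eq_bigr => i _; rewrite coordZ.
have lift k (y : 'I_k -> Res N) :
    exists Y : 'M[R]_(k, b), forall i, coord (row i Y) = y i.
  have /choice[Y yY] i := eN (y i).
  exists (\matrix_(i, j) Y i j) => i.
  by rewrite yY; apply: eq_bigr => j _; rewrite !mxE.
pose Rel := [set y : 'rV[R]_b | coord y = 0].
have subRel : is_submodule Rel.
  split=> [//|y z /= y0 z0|a y /= y0]; first by rewrite /Rel /= coordD y0 z0 addr0.
  by rewrite /Rel /= coordZ y0 scaler0.
pose L := [set Y : 'M[R]_(t + n, b) | exists m : M, forall i, coord (row i Y) = F i m].
have subL : is_submodule L.
  split.
  - by exists 0 => i; rewrite row0 coord0 linear0.
  - move=> Y Z [m Ym] [m' Zm']; exists (m + m') => i.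
    by rewrite linearD coordD Ym Zm' linearD.
  - move=> a Y [m Ym]; exists (a *: (m : Res M)) => i.
    by rewrite linearZ coordZ Ym linear_resZ.
(* A local surjection onto k copies lifts to k maps M -> N, which are combinations of the F_i; this
   bounds the capacity of the family from below. *)
have cap1 p : X p -> capacity Rel L p (1%:M : 'M_(t + n)) (minn (t + n) (t + d p)).
  move=> Xp; have [k le_k [h hsurj]] := locsurj p Xp.
  apply: (capacity_le subRel (k := k)); first by rewrite geq_min le_k orbT.
  have [f fsurj] := surj_of_loc noethR fgM fgNR hsurj.
  have /choice[V fV] j := Fspan (f j).
  exists (\matrix_(j, i) V j i); rewrite mulmx1.
  apply: surj_at_pointwise => // Y.
  have [s ns [m fm]] := fsurj (fun j => coord (row j Y)).
  have [l lm] := lift _ (fun i => F i m).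
  exists s; split=> //; exists l; split; first by exists m.
  move=> j; rewrite /Rel /= linearB linearZ /= row_mul.
  rewrite coordD -scaleN1r !coordZ coord_mul scaleN1r -fm fV.
  by apply/eqP; rewrite subr_eq0; apply/eqP; apply: eq_bigr => i _; rewrite !mxE lm.
have [T capT] := capacity_descent subRel subL noethR jSpec_Supp_bigcap d_lt cap1.
have surjT p : X p -> surj_at Rel L p T.
  move=> Xp; apply: surj_at_square => //; last exact: capT.
  move=> [s ns sRel]; have [_] := Xp; apply/(not_SuppP p fgNR).
  exists s => // v; have [Y vY] := lift 1%N (fun=> v).
  by rewrite -(vY 0) -coordZ; exact: sRel.
have glin : linear (fun m : M => [ffun j => \sum_i T j i *: (F i m : Res N) : N]).
  move=> a m m'; apply/ffunP => j; rewrite !ffunE.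
  transitivity (\sum_i (ract (T j i *: (F i m : Res N) : N) a
                        + (T j i *: (F i m' : Res N) : N))).
    apply: eq_bigr => i _; rewrite linearP scalerDr; congr (_ + _).
    by symmetry; exact: ract_resZ.
  by rewrite big_split; congr (_ + _); symmetry; exact: scaler_sumr.
pose g : {linear M -> {ffun 'I_t -> N}} := HB.pack
  (fun m : M => [ffun j => \sum_i T j i *: (F i m : Res N) : N])
  (GRing.isLinear.Build _ _ _ _ _ glin).
exists g; apply: surjective_of_loc => p Xp y.
have [s ns surjs] := surjT p Xp; exists s => //.
have [Y Yy] := lift _ y; have [l [[m lm] relY]] := surjs Y.
exists m => j; rewrite ffunE -Yy.
have := relY j; rewrite /Rel /= linearB linearZ /= row_mul.
rewrite coordD -scaleN1r !coordZ coord_mul scaleN1r => /eqP.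
rewrite subr_eq0 => /eqP <-.
by apply: eq_bigr => i _; rewrite mxE lm.
Qed.

End Gluing.

(** * Suprema and Krull dimension *)

Section ExtendedIntegers.
Local Open Scope ereal_scope.

(** The common shape of [sur] and [krull_dim], to which both reduce by conversion. *)
Definition nat_sup (A : set nat) : \bar int :=
  supremum -oo [set (n%:Z)%:E | n in A].

(** [supremum] is meaningful only if a least upper bound exists: it is the maximum for a bounded set
    and +oo for an unbounded one. *)
Lemma nat_supremums_ereal (A : set nat) : A !=set0 ->
  supremums [set (n%:Z)%:E | n in A] !=set0.
Proof.
move=> [a Aa]; have [[b bA]|nbd] := pselect (exists b, forall n, A n -> (n <= b)%N).
  have exA : exists n, `[< A n >] by exists a; exact/asboolP.
  have [n /asboolP|m /asboolP Am mmax] := ex_maxnP exA (m := b); first exact: bA.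
  exists (m%:Z)%:E; split=> [_ [n An <-]|u]; last by apply; exists m.
  by rewrite lee_fin lez_nat; apply: mmax; exact/asboolP.
exists +oo; split=> [_ [n An <-]|u ubu]; first exact: leey.
case: u ubu => [r|//|] ubu; last by have := ubu _ (ex_intro2 _ _ a Aa erefl).
case: nbd; exists `|r|%N => n An.
have := ubu _ (ex_intro2 _ _ n An erefl); rewrite lee_fin => nr.
by rewrite -lez_nat gez0_abs // (le_trans _ nr).
Qed.

Lemma nat_sup_ge (A : set nat) n : A n -> (n%:Z)%:E <= nat_sup A.
Proof.
move=> An; apply: ge_supremum_Nmem; last by exists n.
by apply: nat_supremums_ereal; exists n.
Qed.

Lemma nat_sup_le (A : set nat) (u : \bar int) :
  (forall n, A n -> (n%:Z)%:E <= u) -> nat_sup A <= u.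
Proof.
move=> Au; rewrite /nat_sup /supremum; case: ifPn => [_|/set0P[_ [n An _]]].
  exact: leNye.
case: xgetP => [y _ [_ lby]|]; first by apply: lby => _ [m Am <-]; exact: Au.
have [|y ysup] := @nat_supremums_ereal A; first by exists n.
by move=> /(_ y).
Qed.

Lemma nat_sup_attained (A : set nat) (k : nat) : (0 < k)%N ->
  (k%:Z)%:E <= nat_sup A -> exists2 n, (k <= n)%N & A n.
Proof.
case: k => // k _ kA; apply: contrapT => nA.
suff : nat_sup A <= (k%:Z)%:E.
  by move=> /(le_trans kA); rewrite lee_fin lez_nat ltnn.
apply: nat_sup_le => n An; rewrite lee_fin lez_nat leqNgt.
by apply/negP => lt_kn; apply: nA; exists n.
Qed.

(** The greatest lower bound exists: it is -oo if no integer bounds A below, +oo if A is so bounded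
    without finite members, and otherwise the finite member nearest to a lower bound z. *)
Lemma infimum_ereal_le (A : set (\bar int)) x : A x -> infimum +oo A <= x.
Proof.
move=> Ax; apply: le_infimum_Nmem => //.
have [[z zA]|nlb] := pselect (exists z : int, forall y, A y -> z%:E <= y); last first.
  exists -oo; split=> [y _|u lbu]; first exact: leNye.
  case: u lbu => [r||//] lbu; case: nlb.
    by exists r => y; exact: lbu.
  by exists 0%R => y /lbu; rewrite leye_eq => /eqP ->; exact: leey.
have [[r0 Ar0]|nfin] := pselect (exists r : int, A r%:E); last first.
  exists +oo; split=> [y Ay|u _]; last exact: leey.
  case: y Ay => // [r Ar|/zA //]; case: nfin; by exists r.
have exA : exists n : nat, `[< A (z + n%:Z)%:E >].
  exists `|(r0 - z)%R|%N; apply/asboolP.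
  by rewrite gez0_abs ?subr_ge0 -?lee_fin ?zA // addrC subrK.
case: (ex_minnP exA) => m /asboolP Am mmin.
exists (z + m%:Z)%:E; split=> [y Ay|u]; last exact.
case: y Ay => [r Ar|_|/zA//]; last exact: leey.
have zr : (z <= r)%R by rewrite -lee_fin; exact: zA.
rewrite lee_fin -lerBrDl -[(r - z)%R]gez0_abs ?subr_ge0 // lez_nat.
by apply: mmin; apply/asboolP; rewrite gez0_abs ?subr_ge0 // addrC subrK.
Qed.

End ExtendedIntegers.

(** * Chains of irreducible closed sets in subspaces of Spec R *)

Section SpectralChains.
Variable R : comPzRingType.
Implicit Types (p q : Spec R) (Y W : set (Spec R)) (E F : set R).

Definition zero_locus E : set (Spec R) := [set p : Spec R | E `<=` spec_ideal p].

Lemma closed_zariskiP W : closed W <-> exists E, W = zero_locus E.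
Proof.
split=> [/closed_openC [E WE]|[E ->]].
  by exists E; rewrite -[LHS]setCK WE setCK.
by rewrite -openC; exists E.
Qed.

Lemma closed_set_typeP Y (Z : set (set_type Y)) :
  closed Z <-> exists E, Z = [set z | zero_locus E (set_val z)].
Proof.
split=> [/closed_openC[U oU UZ]|[E ->]].
  have [E UE] : exists E, ~` U = zero_locus E.
    by apply/closed_zariskiP; exact: open_closedC.
  exists E; rewrite -[LHS]setCK -UZ.
  by apply/seteqP; split=> z /=; rewrite -[zero_locus E _]/((zero_locus E) _) -UE.
apply: (@closed_comp _ _ (@set_val _ Y)); last by apply/closed_zariskiP; exists E.
by move=> z _; exact: initial_continuous.
Qed.

(* The irreducible closed subsets of the subspace Y, as subsets of Spec R. *)
Definition irreducible_closed_in Y W : Prop :=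
  [/\ W !=set0, exists E, W = Y `&` zero_locus E &
      forall E F, W `<=` zero_locus E `|` zero_locus F ->
        W `<=` zero_locus E \/ W `<=` zero_locus F].

Lemma irreducible_closed_image Y (Z : set (set_type Y)) :
  closed Z -> irreducible Z -> irreducible_closed_in Y (set_val @` Z).
Proof.
move=> /closed_set_typeP[E ZE] [[z Zz] irrZ]; split.
- by exists (set_val z), z.
- exists E; apply/seteqP; split=> [_ [y Zy <-]|p [Yp Ep]].
    by split; [exact: set_valP|move: Zy; rewrite ZE].
  by exists (SigSub (mem_set Yp)) => //; rewrite ZE.
move=> F G ZFG.
have [|||h|h] :=
  irrZ [set z | zero_locus F (set_val z)] [set z | zero_locus G (set_val z)].
- by apply/closed_set_typeP; exists F.
- by apply/closed_set_typeP; exists G.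
- by move=> y Zy; apply: ZFG; exists y.
- by left=> _ [y Zy <-]; exact: h.
- by right=> _ [y Zy <-]; exact: h.
Qed.

Lemma irreducible_closed_preimage Y W : irreducible_closed_in Y W ->
  closed (@set_val _ Y @^-1` W) /\ irreducible (@set_val _ Y @^-1` W).
Proof.
move=> [[p Wp] [E WE] irrW].
have sub y : W y -> Y y by rewrite WE => -[].
split.
  apply/closed_set_typeP; exists E; apply/seteqP; split=> z /=; rewrite WE; first by case.
  by move=> Ez; split=> //; exact: set_valP.
split; first by exists (SigSub (mem_set (sub p Wp))).
move=> A B /closed_set_typeP[F ->] /closed_set_typeP[G ->] WFG.
have [y Wy||] := irrW F G; last 2 first.
- by move=> h; left => z Wz; exact: h.
- by move=> h; right => z Wz; exact: h.
exact: (WFG (SigSub (mem_set (sub y Wy)))).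
Qed.

Definition chain_lengths Y : set nat :=
  [set n | exists Z : nat -> set (set_type Y), irreducible_chain n Z].

Lemma chain_lengthsP Y n : chain_lengths Y n <->
  exists W : nat -> set (Spec R),
    (forall i, (i <= n)%N -> irreducible_closed_in Y (W i)) /\
    (forall i, (i < n)%N -> W i `<` W i.+1).
Proof.
split=> [[Z [Zirr Zlt]]|[W [Wirr Wlt]]].
  exists (fun i => set_val @` Z i); split=> i le_in.
    by case: (Zirr i le_in); exact: irreducible_closed_image.
  have [sub nsub] := Zlt i le_in; split; first exact: image_subset.
  move=> h; apply: nsub => z Zz; have [|y Zy yz] := h (set_val z); first by exists z.
  by have <- : y = z by exact/val_inj.
exists (fun i => @set_val _ Y @^-1` W i); split=> i le_in.
  exact: irreducible_closed_preimage (Wirr i le_in).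
have [sub nsub] := Wlt i le_in; split; first by move=> z; exact: sub.
move=> h; apply: nsub => y Wy.
have Yy : Y y by have [_ [E WE] _] := Wirr i.+1 le_in; move: Wy; rewrite WE => -[].
exact: (h (SigSub (mem_set Yy))).
Qed.

(** p is a generic point: a zero locus containing p contains every prime above it. *)
Lemma irreducible_closed_Var (X : set (Spec R)) p : X p ->
  irreducible_closed_in (Var p `&` X) (Var p `&` X).
Proof.
move=> Xp; split.
- by exists p; split=> // x.
- by exists set0; apply/seteqP; split=> [q Yq|q []//]; split=> // x [].
by move=> E F /(_ p (conj (@subset_refl _ _) Xp))[] h; [left|right] => q [pq _];
   exact: subset_trans h pq.
Qed.

Lemma chain_lengths0 (X : set (Spec R)) p : X p -> chain_lengths (Var p `&` X) 0.
Proof.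
by move=> Xp; apply/chain_lengthsP; exists (fun=> Var p `&` X); split=> // i _;
   exact: irreducible_closed_Var.
Qed.

(** The set of points of X above q is put on top of the chain; the inclusion is strict because q
    does not contain p. *)
Lemma chain_lengthsS (X : set (Spec R)) p q n : X q ->
  spec_ideal q `<=` spec_ideal p -> q <> p ->
  chain_lengths (Var p `&` X) n -> chain_lengths (Var q `&` X) n.+1.
Proof.
move=> Xq qp nqp /chain_lengthsP[W [Wirr Wlt]]; apply/chain_lengthsP.
have sub i : (i <= n)%N -> W i `<=` Var p `&` X.
  by move=> /Wirr[_ [E ->] _] x [].
exists (fun i => if (i <= n)%N then W i else Var q `&` X); split=> i le_in.
  case: ifP => le_in'; last exact: irreducible_closed_Var.
  have [W0 [E WE] irrW] := Wirr i le_in'; split=> //.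
  (* A closed subset of the smaller space is closed in the larger one once the equations of p are
     added. *)
  exists (E `|` spec_ideal p); rewrite WE; apply/seteqP; split=> x.
    move=> [[px Xx] Ex]; split; last by move=> y [/Ex|/px].
    by split=> //; exact: subset_trans qp px.
  by move=> [[qx Xx] EPx]; split; [split=> // y py; apply: EPx; right
    |move=> y Ey; apply: EPx; left].
rewrite -ltnS le_in; case: ifP => lt_in; first exact: Wlt.
have -> : i = n by apply/eqP; rewrite eqn_leq -ltnS le_in leqNgt lt_in.
split=> [x /(sub n (leqnn n))[px Xx]|h].
  by split=> //; exact: subset_trans qp px.
have [|pq _] := sub n (leqnn n) q; first by apply: h; split.
by apply: nqp; apply/Spec_inj/seteqP.
Qed.

End SpectralChains.

Theorem theorem0p8 (R : comPzRingType) (S : pzRingType) (phi : algebra R S)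
    (M N : lmodType S^c) (X : set (Spec R)) :
  noetherian R ->
  fg_module (alg_module phi) ->
  fg_module M ->
  fg_module N ->
  X = jSpec R `&` Supp phi N ->
  (spec_dim X < +oo)%E ->
  (sur M N >=
   infimum +oo
     [set sur (loc_module p phi M) (loc_module p phi N) - dim_at X p
       | p in X])%E.
Proof.
move=> noethR fgS fgM fgN XE _; set inf := infimum _ _.
(* It suffices to realize every positive integer t below the infimum: the zero map gives sur >= 0,
   which settles t = 0 and negative infima, and an infimum +oo makes every t available. *)
suff key (t : nat) : (0 < t)%N -> ((t%:Z)%:E <= inf)%E ->
    exists f : {linear M -> {ffun 'I_t -> N}}, forall y, exists x, f x = y.
  have sur_ge t : ((t%:Z)%:E <= inf)%E -> ((t%:Z)%:E <= sur M N)%E.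
    case: t => [_|t tinf]; apply: nat_sup_ge; last exact: key.
    by exists \0 => y; exists 0; apply/ffunP => -[].
  case: inf key sur_ge => [r||] _ sur_ge; last exact: leNye.
    case: r sur_ge => [t|t] sur_ge; first exact: sur_ge.
    by apply: le_trans (nat_sup_ge (n := 0) _); rewrite ?lee_fin //;
       exists \0 => y; exists 0; apply/ffunP => -[].
  case: (sur M N) sur_ge => [r||] // sur_ge; last by have := sur_ge 0%N (leey _).
  have := sur_ge `|r|.+1 (leey _); rewrite lee_fin leNgt => /negP[].
  by case: r {sur_ge} => n //; rewrite ltz_nat ltnSn.
move=> t0 t_inf.
have t_le p : X p -> ((t%:Z)%:E <=
    sur (loc_module p phi M) (loc_module p phi N) - dim_at X p)%E.
  by move=> Xp; apply: le_trans t_inf _; apply: infimum_ereal_le; exists p.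
(* The one-member chain makes the dimension at p nonnegative, and the value +oo would make the
   difference -oo, below t. *)
have /choice[d dP] p : exists d : nat, X p -> dim_at X p = (d%:Z)%:E.
  have [Xp|nXp] := pselect (X p); last by exists 0%N.
  have := nat_sup_ge (chain_lengths0 Xp); rewrite -[nat_sup _]/(dim_at X p).
  have := t_le p Xp; case: (dim_at X p) => [[d|d]||] //; last by rewrite addeNy.
  by move=> _ _; exists d.
(* The supremum is attained: some chain has length exactly [d p], and it can be prolonged. *)
have d_length p : X p -> chain_lengths (Var p `&` X) (d p).
  move=> Xp; have := dP p Xp; case: (d p) => [_|k dim_p]; first exact: chain_lengths0.
  have [||n le_kn nP] := @nat_sup_attained (chain_lengths (Var p `&` X)) k.+1 => //.
    by rewrite -dim_p.
  have := nat_sup_ge nP; rewrite -[nat_sup _]/(dim_at X p).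
  rewrite dim_p lee_fin lez_nat => le_nk.
  by have <- : n = k.+1 by apply/eqP; rewrite eqn_leq le_nk.
rewrite {}XE in t_le d dP d_length *.
apply: (surjective_of_local_capacity noethR fgS fgM fgN (phi := phi) (d := d)).
  move=> p q Xp Xq qp nqp; rewrite -lez_nat -lee_fin -(dP q Xq).
  exact: nat_sup_ge (chain_lengthsS Xq qp nqp (d_length p Xp)).
(* In the form t + dim_X(p) <= sur at p, the bound yields a surjection onto k copies of N_p with k
   >= t + d p. *)
move=> p Xp; have := t_le p Xp; rewrite (dP p Xp) leeBrDr // -EFinD -PoszD.
by move=> /nat_sup_attained[|n le_n [h hsurj]];
  [rewrite addn_gt0 t0|exists n => //; exists h].
Qed.
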